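(* Suppose that $\bar x\in\mathcal F(\bar\omega)$ satisfies the quadratic growth condition for $NLP(\bar\omega)$, that MFCQ is satisfied at $\bar x$ (for $NLP(\bar\omega)$), and that the functions $f$, $g$ and $h$ are twice continuously differentiable near $(\bar x,\bar\omega)$. Then $X$ and $S$ are locally nonempty-valued and upper Hölder of order $\frac12$ at $(\bar\omega,\bar x)$, i.e., there are neighborhoods $U$ of $\bar x$, $W$ of $\bar\omega$ and a constant $L>0$ such that $$\emptyset\neq X(\omega)\cap U\subset S(\omega)\cap U\subset\{\bar x\}+L\|\omega-\bar\omega\|^{\frac12}\mathcal B_{\mathbb R^n}\quad\forall\omega\in W.$$
   Context: $NLP(\omega)$: minimize $f(x,\omega)$ over $x\in\mathbb R^n$ subject to $g(x,\omega)\le0$, $h(x,\omega)=0$, where $f:\mathbb R^n\times\mathbb R^s\to\mathbb R$, $g:\mathbb R^n\times\mathbb R^s\to\mathbb R^{m_I}$, $h:\mathbb R^n\times\mathbb R^s\to\mathbb R^{m_E}$ are continuous, and $\bar\omega\in\mathbb R^s$. $\mathcal F(\omega)$ is the feasible set of $NLP(\omega)$, and $\mathcal B_{\mathbb R^n}$ is the closed unit ball. Standing assumptions (with $q=(g,h)$): there are neighborhoods $U_0$ of $\bar x$ and $W_0$ of $\bar\omega$ such that $f,q$ are twice partially differentiable with respect to $x$ on $U_0\times W_0$; $q,\nabla_xf,\nabla_xq,\nabla_x^2f,\nabla_x^2q$ are continuous at $(\bar x,\bar\omega)$; $\nabla_x^2f(\cdot,\omega),\nabla_x^2q(\cdot,\omega)$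 are continuous on $U_0$ for every $\omega\in W_0$; and $f(\bar x,\cdot)$, $\nabla_xf(\bar x,\cdot)$, $q(\bar x,\cdot)$, $\nabla_xq(\bar x,\cdot)$ are Lipschitzian near $\bar\omega$. $X(\omega)$ is the set of local minimizers of $NLP(\omega)$. $S(\omega):=\{x\mid0\in\nabla_xf(x,\omega)+\hat N(x;\mathcal F(\omega))\}$ is the set of (B-)stationary points, where $\hat N(x;\Gamma):=\{\xi\mid\limsup_{x'\to x,\,x'\in\Gamma}\xi^T(x'-x)/\|x'-x\|\le0\}$ for $x\in\Gamma$ and $\hat N(x;\Gamma)=\emptyset$ otherwise. Quadratic growth condition at $\bar x$ for $NLP(\bar\omega)$: there are $\eta>0$ and a neighborhood $V$ of $\bar x$ with $f(x,\bar\omega)-f(\bar x,\bar\omega)\ge\eta\|x-\bar x\|^2$ for all $x\in V\cap\mathcal F(\bar\omega)$. MFCQ (Mangasarian-Fromovitz constraint qualification) at $\bar x$: the gradients $\nabla_xh_i(\bar x,\bar\omega)$, $i=1,\dots,m_E$, are linearly independent and there is $d\in\mathbb R^n$ with $\nabla_xh_i(\bar x,\bar\omega)d=0$ for all $i$ and $\nabla_xg_i(\bar x,\bar\omega)d<0$ for all $i$ with $g_i(\bar x,\bar\omega)=0$. *)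

(* Defs.v *)
From HB Require Import structures.
From mathcomp Require Import all_boot all_order all_algebra.
From mathcomp Require Import all_classical all_reals all_analysis.
Set Implicit Arguments.
Unset Strict Implicit.
Unset Printing Implicit Defensive.
Import Order.TTheory GRing.Theory Num.Theory.
Import numFieldNormedType.Exports.
Local Open Scope classical_set_scope.
Local Open Scope ring_scope.

(* R^n is 'rV[R]_n; a function on R^n x R^s has domain
   'rV[R]_n * 'rV[R]_s and is written with argument (x, w). *)

(* The library norm of 'rV[R]_n is the sup norm. *)
Definition enorm (R : realType) (n : nat) (x : 'rV[R]_n) : R :=
  Num.sqrt (\sum_(i < n) x 0 i ^+ 2).

Definition eball (R : realType) (n : nat) : set 'rV[R]_n :=
  [set b | enorm b <= 1].

Definition dotp (R : realType) (n : nat) (u v : 'rV[R]_n) : R :=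
  \sum_(i < n) u 0 i * v 0 i.

Definition coordf (R : realType) (T : Type) (m : nat) (F : T -> 'rV[R]_m)
  (i : 'I_m) : T -> R := fun z => F z 0 i.

Definition grad_x (R : realType) (n s : nat)
  (phi : 'rV[R]_n * 'rV[R]_s -> R) (z : 'rV[R]_n * 'rV[R]_s) : 'rV[R]_n :=
  \row_(i < n) 'D_(delta_mx 0 i) (fun y : 'rV[R]_n => phi (y, z.2)) z.1.

Definition hess_x (R : realType) (n s : nat)
  (phi : 'rV[R]_n * 'rV[R]_s -> R) (z : 'rV[R]_n * 'rV[R]_s) : 'M[R]_n :=
  \matrix_(i < n, j < n)
    'D_(delta_mx 0 j) (fun y : 'rV[R]_n => grad_x phi (y, z.2) 0 i) z.1.

(* Row i is the gradient of the i-th component; the library's 'J is the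
   transpose. *)
Definition jac_x (R : realType) (n s m : nat)
  (F : 'rV[R]_n * 'rV[R]_s -> 'rV[R]_m) (z : 'rV[R]_n * 'rV[R]_s)
  : 'M[R]_(m, n) :=
  \matrix_(i < m) grad_x (coordf F i) z.

Definition lipschitz_near (R : realType) (V W : normedModType R)
  (F : V -> W) (p : V) : Prop :=
  exists2 A : set V, nbhs p A & [lipschitz F y | y in A].

Record partially_smooth (R : realType) (n s : nat)
    (U0 : set 'rV[R]_n) (W0 : set 'rV[R]_s)
    (xbar : 'rV[R]_n) (wbar : 'rV[R]_s)
    (phi : 'rV[R]_n * 'rV[R]_s -> R) : Prop := PartiallySmooth {
  ps_diff : forall x w, U0 x -> W0 w ->
    differentiable (fun y : 'rV[R]_n => phi (y, w)) x;
  ps_diff2 : forall x w, U0 x -> W0 w ->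
    differentiable (fun y : 'rV[R]_n => grad_x phi (y, w)) x;
  ps_grad_cont : {for (xbar, wbar), continuous (grad_x phi)};
  ps_hess_cont : {for (xbar, wbar), continuous (hess_x phi)};
  ps_hess_cont_x : forall w, W0 w ->
    {within U0, continuous (fun x : 'rV[R]_n => hess_x phi (x, w))};
  ps_lip : lipschitz_near (fun w : 'rV[R]_s => phi (xbar, w)) wbar;
  ps_grad_lip : lipschitz_near (fun w : 'rV[R]_s => grad_x phi (xbar, w)) wbar
}.

(* Continuity of g and h at (xbar, wbar) is not repeated here: the problem
   functions are continuous everywhere. *)
Definition standing_assumptions (R : realType) (n s mI mE : nat)
  (f : 'rV[R]_n * 'rV[R]_s -> R)
  (g : 'rV[R]_n * 'rV[R]_s -> 'rV[R]_mI)
  (h : 'rV[R]_n * 'rV[R]_s -> 'rV[R]_mE)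
  (xbar : 'rV[R]_n) (wbar : 'rV[R]_s) : Prop :=
  exists (U0 : set 'rV[R]_n) (W0 : set 'rV[R]_s),
    [/\ nbhs xbar U0, nbhs wbar W0,
        partially_smooth U0 W0 xbar wbar f,
        forall i, partially_smooth U0 W0 xbar wbar (coordf g i) &
        forall i, partially_smooth U0 W0 xbar wbar (coordf h i)].

(* Meant for finite-dimensional V, where differentiability of z |-> 'd F z and
   continuity of the second derivative are equivalent to the same properties
   of the directional derivatives below. *)
Definition C2_near (R : realType) (V W : normedModType R) (F : V -> W) (p : V)
  : Prop :=
  \forall z \near p,
    [/\ differentiable F z,
        forall v : V, differentiable ('D_v F) z &
        forall v v' : V, {for z, continuous ('D_v' ('D_v F))}].

Definition feasible (R : realType) (n s mI mE : nat)
  (g : 'rV[R]_n * 'rV[R]_s -> 'rV[R]_mI)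
  (h : 'rV[R]_n * 'rV[R]_s -> 'rV[R]_mE) (w : 'rV[R]_s) : set 'rV[R]_n :=
  [set x | (forall i, g (x, w) 0 i <= 0) /\ h (x, w) = 0].

Definition local_minimizers (R : realType) (n s mI mE : nat)
  (f : 'rV[R]_n * 'rV[R]_s -> R)
  (g : 'rV[R]_n * 'rV[R]_s -> 'rV[R]_mI)
  (h : 'rV[R]_n * 'rV[R]_s -> 'rV[R]_mE) (w : 'rV[R]_s) : set 'rV[R]_n :=
  [set x | feasible g h w x /\
           \forall y \near x, feasible g h w y -> f (x, w) <= f (y, w)].

(* The limsup is over x' in G tending to x with x' <> x; it is -oo when x is
   isolated in G, in which case the cone is the whole space. *)
Definition regular_normal_cone (R : realType) (n : nat) (G : set 'rV[R]_n)
  (x : 'rV[R]_n) : set 'rV[R]_n :=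
  [set xi | G x /\
    (limf_esup
       (fun x' : 'rV[R]_n => (dotp xi (x' - x) / enorm (x' - x))%:E)
       (within G x^') <= 0)%E].

Definition stationary_points (R : realType) (n s mI mE : nat)
  (f : 'rV[R]_n * 'rV[R]_s -> R)
  (g : 'rV[R]_n * 'rV[R]_s -> 'rV[R]_mI)
  (h : 'rV[R]_n * 'rV[R]_s -> 'rV[R]_mE) (w : 'rV[R]_s) : set 'rV[R]_n :=
  [set x | exists2 xi, regular_normal_cone (feasible g h w) x xi &
                       0 = grad_x f (x, w) + xi].

Definition quadratic_growth (R : realType) (n s mI mE : nat)
  (f : 'rV[R]_n * 'rV[R]_s -> R)
  (g : 'rV[R]_n * 'rV[R]_s -> 'rV[R]_mI)
  (h : 'rV[R]_n * 'rV[R]_s -> 'rV[R]_mE)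
  (xbar : 'rV[R]_n) (wbar : 'rV[R]_s) : Prop :=
  exists (eta : R) (V : set 'rV[R]_n),
    [/\ 0 < eta, nbhs xbar V &
        forall x, (V `&` feasible g h wbar) x ->
          f (x, wbar) - f (xbar, wbar) >= eta * enorm (x - xbar) ^+ 2].

Definition MFCQ (R : realType) (n s mI mE : nat)
  (g : 'rV[R]_n * 'rV[R]_s -> 'rV[R]_mI)
  (h : 'rV[R]_n * 'rV[R]_s -> 'rV[R]_mE)
  (xbar : 'rV[R]_n) (wbar : 'rV[R]_s) : Prop :=
  row_free (jac_x h (xbar, wbar)) /\
  exists d : 'rV[R]_n,
    (forall i, dotp (grad_x (coordf h i) (xbar, wbar)) d = 0) /\
    (forall i, g (xbar, wbar) 0 i = 0 ->
               dotp (grad_x (coordf g i) (xbar, wbar)) d < 0).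

(* Main.v *)
Require Import Defs.
From HB Require Import structures.
From mathcomp Require Import all_boot all_order all_algebra.
From mathcomp Require Import all_classical all_reals all_analysis.
From mathcomp Require Import ring lra.
Set Implicit Arguments.
Unset Strict Implicit.
Unset Printing Implicit Defensive.
Import Order.TTheory GRing.Theory Num.Theory.
Import numFieldNormedType.Exports.
Local Open Scope classical_set_scope.
Local Open Scope ring_scope.

(** Write [t] for the distance from [x] to the reference solution [xb] and [d]
for the distance from [w] to the reference parameter [wb].  The constraints
[g <= 0] and [h = 0] are treated as one map [q] with Jacobian [J]; a multiplier
is a row vector [l] that is nonnegative on the inequalities.

MFCQ enters through its dual form [kappa * |l| <= |l *m J|] for multipliers
supported on the active constraints ([MFCQ_pos_indep]), an inequality which
survives small perturbations of the point.  It has two consequences.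

- The constraints are metrically regular, uniformly in the parameter
  ([metric_regularity]): minimize the Euclidean norm of the violation plus
  [c * |y - x|] over a ball.  Where the violation is nonzero its gradient is a
  normalized combination [l *m J], too long to be balanced by [c], so the
  minimizer is feasible, and comparison with [x] bounds its distance to [x].
- Stationary points near [xb] have bounded multipliers
  ([stationary_multiplier]).

The Hölder estimate compares two bounds for [f (x, wb) - f (xb, wb)], where
[x] is stationary for the parameter [w].

From below ([growth_lower]), [x] lies within [O(d) + o(t^2)] of a point feasible
for [wb], so the growth condition gives [eta/2 * t^2 - O(d) - o(t^2)].

From above ([stationary_upper]), let [l] be a multiplier of [x].  By compactness
the multiplier equation at [xb] has a solution [l'] close to [l] whose support
lies in that of [l] ([limit_multiplier]).  Apply the trapezoid rule to the Lagrangian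
[f + l' q] between [xb] and [x].  Its gradient vanishes at [xb]; at [x] it
is, up to [O(d) + o(t)], equal to [(l' - l) *m J].  If [l k] is nonzero then
the constraint [k] is active at both points, so [J (x - xb)] has [k]-th
coordinate [O(d) + O(t^2)], and the trapezoid sum is [O(d) + o(t^2)].  For the
same reason [l' q] contributes only [O(d) + o(t^2)].  Hence
[f (x, wb) - f (xb, wb) <= O(d) + o(t^2)], and the two bounds give
[t^2 = O(d)].

Second-order sufficient conditions would not lead to this result directly:
quadratic growth provides a multiplier with positive curvature that depends on
the direction, and it need not be the multiplier close to [l].  The argument
above compares the gradients at the two end points instead.

For existence ([minimizer_exists]), minimize [f] over the feasible points of
a small ball.  Metric regularity makes this set nonempty, and the bound from
below keeps the minimizer off the boundary, so it is a local minimizer. *)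

(** * Norms and inner products of row vectors *)

Section RowVectors.
Context {R : realType}.

Lemma sum_le_const n (F : 'I_n -> R) c :
  (forall i, F i <= c) -> \sum_i F i <= n%:R * c.
Proof.
by move=> Fc; rewrite (le_trans (ler_sum _ (fun i _ => Fc i)))// sumr_const
  card_ord mulr_natl.
Qed.

Lemma coord_le_norm m n (A : 'M[R]_(m, n)) i j : `|A i j| <= `|A|.
Proof.
rewrite [leRHS]/Num.norm /= mx_normrE.
by apply/bigmax_geP; right => /=; exists (i, j).
Qed.

Lemma coordB_le_norm m n (A B : 'M[R]_(m, n)) i j :
  `|A i j - B i j| <= `|A - B|.
Proof. by apply: le_trans (coord_le_norm _ i j); rewrite !mxE. Qed.

Lemma norm_le_coord m n (A : 'M[R]_(m, n)) (M : R) : 0 <= M ->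
  (forall i j, `|A i j| <= M) -> `|A| <= M.
Proof.
move=> M0 AM; rewrite [leLHS]/Num.norm /= mx_normrE.
by apply/bigmax_leP; split => // -[i j] _; exact: AM.
Qed.

Lemma dotpC n (u v : 'rV[R]_n) : dotp u v = dotp v u.
Proof. by apply: eq_bigr => i _; rewrite mulrC. Qed.

Lemma dotpDr n (u v w : 'rV[R]_n) : dotp u (v + w) = dotp u v + dotp u w.
Proof. by rewrite -big_split; apply: eq_bigr => i _; rewrite mxE mulrDr. Qed.

Lemma dotpDl n (u v w : 'rV[R]_n) : dotp (v + w) u = dotp v u + dotp w u.
Proof. by rewrite ![dotp _ u]dotpC dotpDr. Qed.

Lemma dotpZr n a (u v : 'rV[R]_n) : dotp u (a *: v) = a * dotp u v.
Proof. by rewrite mulr_sumr; apply: eq_bigr => i _; rewrite mxE mulrCA. Qed.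

Lemma dotpZl n a (u v : 'rV[R]_n) : dotp (a *: u) v = a * dotp u v.
Proof. by rewrite dotpC dotpZr dotpC. Qed.

Lemma dotpNr n (u v : 'rV[R]_n) : dotp u (- v) = - dotp u v.
Proof. by rewrite -scaleN1r dotpZr mulN1r. Qed.

Lemma dotpNl n (u v : 'rV[R]_n) : dotp (- u) v = - dotp u v.
Proof. by rewrite -scaleN1r dotpZl mulN1r. Qed.

Lemma dotpBl n (u v w : 'rV[R]_n) : dotp (v - w) u = dotp v u - dotp w u.
Proof. by rewrite dotpDl dotpNl. Qed.

Lemma dotp0l n (u : 'rV[R]_n) : dotp 0 u = 0.
Proof. by rewrite -(scale0r u) dotpZl mul0r. Qed.

Lemma dotp_suml n (I : finType) (F : I -> 'rV[R]_n) u :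
  dotp (\sum_i F i) u = \sum_i dotp (F i) u.
Proof.
by elim/big_rec2: _ => [|i a b _ <-]; rewrite ?dotp0l ?dotpDl.
Qed.

Lemma dotp_mulmx m n (l : 'rV[R]_m) (J : 'M[R]_(m, n)) u :
  dotp (l *m J) u = \sum_k l 0 k * dotp (row k J) u.
Proof.
by rewrite mulmx_sum_row dotp_suml; apply: eq_bigr => k _; rewrite dotpZl.
Qed.

Lemma dotp_delta n (u : 'rV[R]_n) i : dotp u (delta_mx 0 i) = u 0 i.
Proof.
rewrite /dotp (bigD1 i) //= big1 ?addr0 ?mxE ?eqxx ?mulr1 // => j ji.
by rewrite mxE (negbTE ji) andbF mulr0.
Qed.

Lemma dotp_le n (u v : 'rV[R]_n) : `|dotp u v| <= n%:R * (`|u| * `|v|).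
Proof.
apply: (le_trans (ler_norm_sum _ _ _)).
apply: sum_le_const => i; rewrite normrM.
by apply: ler_pM => //; exact: coord_le_norm.
Qed.

Lemma norm_le_enorm n (v : 'rV[R]_n) : `|v| <= enorm v.
Proof.
apply: norm_le_coord => [|i j]; first exact: sqrtr_ge0.
rewrite ord1 -sqrtr_sqr ler_sqrt; last first.
  by apply: sumr_ge0 => k _; exact: sqr_ge0.
by rewrite (bigD1 j) //= lerDl; apply: sumr_ge0 => k _; exact: sqr_ge0.
Qed.

Lemma sqr_enorm n (v : 'rV[R]_n) : enorm v ^+ 2 = dotp v v.
Proof.
rewrite sqr_sqrtr; last by apply: sumr_ge0 => k _; exact: sqr_ge0.
by apply: eq_bigr => k _; rewrite expr2.
Qed.

Lemma sqr_norm_le_dotp n (v : 'rV[R]_n) : `|v| ^+ 2 <= dotp v v.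
Proof.
by rewrite -sqr_enorm ler_sqr ?nnegrE ?norm_le_enorm// sqrtr_ge0.
Qed.

Lemma enorm_le_norm n (v : 'rV[R]_n) : enorm v <= Num.sqrt n%:R * `|v|.
Proof.
rewrite -[`|v|]normr_id -sqrtr_sqr -sqrtrM ?ler0n// ler_sqrt; last first.
  by rewrite mulr_ge0 ?ler0n// sqr_ge0.
apply: sum_le_const => i; rewrite -real_normK ?num_real// ler_sqr ?nnegrE//.
exact: coord_le_norm.
Qed.

Lemma mulmx_norm_le m n p (A : 'M[R]_(m, n)) (B : 'M[R]_(n, p)) :
  `|A *m B| <= n%:R * (`|A| * `|B|).
Proof.
apply: norm_le_coord => [|i j]; first by rewrite !mulr_ge0 ?ler0n.
rewrite mxE (le_trans (ler_norm_sum _ _ _))//.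
apply: sum_le_const => k; rewrite normrM.
by apply: ler_pM => //; exact: coord_le_norm.
Qed.

End RowVectors.

(** * Directional derivatives and the mean value theorem along a segment *)

Section Derivatives.
Context {R : realType}.

Lemma derive_sum_coord n (psi : 'rV[R]_n -> R) x u : differentiable psi x ->
  'D_u psi x = \sum_j u 0 j * 'D_(delta_mx 0 j) psi x.
Proof.
move=> dpsi; rewrite deriveE// [u in LHS]row_sum_delta linear_sum.
by apply: eq_bigr => j _; rewrite linearZ /= deriveE.
Qed.

Lemma derive_le n (psi : 'rV[R]_n -> R) x u (M : R) : differentiable psi x ->
  (forall j, `|'D_(delta_mx 0 j) psi x| <= M) ->
  `|'D_u psi x| <= n%:R * (M * `|u|).
Proof.
move=> dpsi psiM; rewrite derive_sum_coord//.
apply: (le_trans (ler_norm_sum _ _ _)).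
apply: sum_le_const => j; rewrite normrM mulrC.
by apply: ler_pM => //; exact: coord_le_norm.
Qed.

(** Both derivatives are limits of the same difference quotient. *)
Lemma derive_line {V : normedModType R} (psi : V -> R) x u (s : R) :
  differentiable psi (x + s *: u) ->
  is_derive s 1 (fun t => psi (x + t *: u)) ('D_u psi (x + s *: u)).
Proof.
move=> dpsi.
have eqf : (fun h : R => h^-1 *: ((((fun t => psi (x + t *: u)) \o shift s)
    (h *: (1 : R^o))) - psi (x + s *: u))) =
  (fun h : R => h^-1 *: ((psi \o shift (x + s *: u)) (h *: u)
    - psi (x + s *: u))).
  apply/funext => h /=; congr (_ *: (psi _ - _)).
  by rewrite [h *: 1]mulr1 scalerDl addrCA.
have := @diff_derivable _ _ _ psi _ u dpsi; rewrite /derivable => cu.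
by split; rewrite /derivable /derive eqf.
Qed.

Lemma mvt_segment {V : normedModType R} (psi : V -> R) (x u : V) :
  (forall s, 0 <= s <= 1 -> differentiable psi (x + s *: u)) ->
  exists2 s, 0 <= s <= 1 & psi (x + u) - psi x = 'D_u psi (x + s *: u).
Proof.
move=> dpsi.
have [|||s] := @MVT_segment R (fun t => psi (x + t *: u))
    (fun s => 'D_u psi (x + s *: u)) 0 1.
- exact: ler01.
- by move=> s; rewrite in_itv /= => /andP[s0 s1]; apply: derive_line;
    apply: dpsi; rewrite !ltW.
- apply: derivable_within_continuous => s; rewrite in_itv /= => s01.
  by have [] := derive_line (dpsi s s01).
rewrite in_itv /= scale0r addr0 scale1r subr0 mulr1 => s01 E.
by exists s.
Qed.

Lemma diff_eps {V W : normedModType R} (psi : V -> W) x :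
  differentiable psi x -> forall e, 0 < e ->
  \forall y \near x, `|psi y - psi x - 'D_(y - x) psi x| <= e * `|y - x|.
Proof.
move=> dpsi e e0.
have /eqaddoP/(_ e e0) := diff_locally dpsi.
rewrite [\forall x \near _, _ <= _](near_shift x) sub0r => near_e; near=> y.
have : (fun z => `|(psi \o shift x - (cst (psi x) + 'd psi x)) (z - x)|
    <= e * `|z - x|) y by near: y; exact: near_e.
rewrite !fctE /= subrK opprD addrA deriveE//.
Unshelve. all: by end_near. Qed.

Lemma norm_segment {V : normedModType R} (x u : V) (a : R) :
  0 <= a <= 1 -> `|x + a *: u - x| <= `|u|.
Proof.
move=> /andP[a0 a1]; rewrite addrC addKr normrZ ger0_norm//.
by rewrite ler_piMl.
Qed.

Lemma ball_segment n (c x y : 'rV[R]_n) (r a : R) :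
  0 <= a <= 1 -> `|x - c| < r -> `|y - c| < r -> `|x + a *: (y - x) - c| < r.
Proof.
move=> /andP[a0 a1] xr yr.
have -> : x + a *: (y - x) - c = (1 - a) *: (x - c) + a *: (y - c).
  rewrite !scalerBr !scalerBl !scale1r; apply/rowP => i; rewrite !mxE; ring.
apply: (le_lt_trans (ler_normD _ _)); rewrite !normrZ !ger0_norm ?subr_ge0//.
have [<-|a0'] := eqVneq 0 a; first by rewrite subr0 mul1r mul0r addr0.
have : a * `|y - c| < a * r by rewrite ltr_pM2l// lt_neqAle a0'.
have : (1 - a) * `|x - c| <= (1 - a) * r by rewrite ler_wpM2l ?subr_ge0// ltW.
lra.
Qed.

Lemma mvt_bound n (psi : 'rV[R]_n -> R) x u (M : R) :
  (forall s, 0 <= s <= 1 -> differentiable psi (x + s *: u) /\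
    forall j, `|'D_(delta_mx 0 j) psi (x + s *: u)| <= M) ->
  `|psi (x + u) - psi x| <= n%:R * (M * `|u|).
Proof.
move=> psiM; have [s s01 ->] := @mvt_segment _ psi x u (fun s h => (psiM s h).1).
by have [dpsi psis] := psiM s s01; exact: derive_le.
Qed.

End Derivatives.

(** * Neighborhoods *)

Section Near.
Context {R : realType}.

Lemma near_radius {V : normedModType R} (p : V) (P : V -> Prop) :
  (\forall z \near p, P z) <->
  exists2 r, 0 < r & forall z, `|z - p| < r -> P z.
Proof.
split=> [/nbhs_normP[r /= r0 Pr]|[r r0 Pr]].
  by exists r => // z zr; apply: Pr; rewrite /= distrC.
by apply/nbhs_normP; exists r => //= z /=; rewrite distrC => /Pr.
Qed.

Lemma near_pair_radius {V W : normedModType R} (p : V) (q : W)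
    (P : V * W -> Prop) :
  (\forall z \near (p, q), P z) <->
  exists2 r, 0 < r & forall x w, `|x - p| < r -> `|w - q| < r -> P (x, w).
Proof.
split=> [/near_radius[r r0 Pr]|[r r0 Pr]].
  by exists r => // x w xr wr; apply: Pr; rewrite /= prod_normE /= gt_max xr.
apply/near_radius; exists r => // -[x w].
by rewrite /= prod_normE /= gt_max => /andP[]; exact: Pr.
Qed.

Lemma near_fst {V W : normedModType R} (p : V) (q : W) (P : V -> Prop) :
  (\forall x \near p, P x) -> \forall z \near (p, q), P z.1.
Proof. by move=> Pp; exact: (cvg_fst Pp). Qed.

Lemma near_snd {V W : normedModType R} (p : V) (q : W) (P : W -> Prop) :
  (\forall x \near q, P x) -> \forall z \near (p, q), P z.2.
Proof. by move=> Pq; exact: (cvg_snd Pq). Qed.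

Lemma near_forall {V : normedModType R} (I : finType) (p : V)
    (P : I -> V -> Prop) :
  (forall k, \forall z \near p, P k z) -> \forall z \near p, forall k, P k z.
Proof. by move=> Pk; apply: (@filter_forall _ _ P) => k; exact: Pk. Qed.

Lemma near_and {V : normedModType R} (p : V) (P Q : V -> Prop) :
  (\forall z \near p, P z) -> (\forall z \near p, Q z) ->
  \forall z \near p, P z /\ Q z.
Proof. by move=> Pp Qp; apply: filterS2 Pp Qp. Qed.

Lemma near_always {V : normedModType R} (p : V) (P : V -> Prop) :
  (forall z, P z) -> \forall z \near p, P z.
Proof. by move=> Pz; apply/near_radius; exists 1. Qed.

Lemma near_slice {V W : normedModType R} (x : V) (w : W) (P : V * W -> Prop) :
  (\forall z \near (x, w), P z) -> \forall y \near x, P (y, w).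
Proof.
move=> /near_pair_radius[r r0 Pr]; apply/near_radius; exists r => // y yr.
by apply: Pr => //; rewrite subrr normr0.
Qed.

Lemma near_near {V : normedModType R} (p : V) (P : V -> Prop) :
  (\forall z \near p, P z) -> \forall z \near p, \forall z' \near z, P z'.
Proof.
move=> /near_radius[r r0 Pr]; apply/near_radius; exists r => // z zr.
apply/near_radius; exists (r - `|z - p|); first by rewrite subr_gt0.
move=> z' z'z; apply: Pr; rewrite -(subrKA z) (le_lt_trans (ler_normD _ _))//.
by rewrite -ltrBrDr.
Qed.

Lemma near_slice2 {V W : normedModType R} (x : V) (w : W) (P : V * W -> Prop) :
  (\forall z \near (x, w), P z) -> \forall v \near w, P (x, v).
Proof.
move=> /near_pair_radius[r r0 Pr]; apply/near_radius; exists r => // v vr.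
by apply: Pr => //; rewrite subrr normr0.
Qed.

Lemma lipschitz_near_bound {V W : normedModType R} (F : V -> W) p :
  lipschitz_near F p -> exists2 C, 0 <= C &
    \forall w \near p, `|F w - F p| <= C * `|w - p|.
Proof.
move=> [A pA /pinfty_ex_gt0[C C0 FC]]; exists C; first exact: ltW.
have Ap : A p by exact: nbhs_singleton.
by near=> w; apply: (FC (w, p)); split => //=; near: w.
Unshelve. all: by end_near. Qed.

End Near.

(** * Second-order estimates for a function smooth in its first argument *)

Section Estimates.
Context {R : realType} {n s : nat}.
Implicit Types (phi : 'rV[R]_n * 'rV[R]_s -> R) (x u : 'rV[R]_n) (w : 'rV[R]_s).

Lemma derive_grad_x phi x w u : differentiable (fun y => phi (y, w)) x ->
  'D_u (fun y => phi (y, w)) x = dotp (grad_x phi (x, w)) u.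
Proof.
move=> dphi; rewrite derive_sum_coord//; apply: eq_bigr => j _.
by rewrite mxE mulrC.
Qed.

Lemma differentiable_row_coord m (F : 'rV[R]_n -> 'rV[R]_m) x i :
  differentiable F x -> differentiable (fun y => F y 0 i) x.
Proof.
by move=> dF; apply: (@differentiable_comp _ _ _ _ F (fun M : 'rV[R]_m => M 0 i)) => //;
  exact: differentiable_coord.
Qed.

(** [C] multiplies the terms that are of the right order by Lipschitz
continuity, [e] those that are small by continuity of the Hessian.  Fixing one
[C] for all problem functions before [e] is chosen is what allows [e] to be
taken small against [C] later. *)
Record expansion (C : R) (xb : 'rV[R]_n) (wb : 'rV[R]_s) phi : Prop := Expansion {
  exp_diff : \forall z \near (xb, wb),
    differentiable (fun y => phi (y, z.2)) z.1;
  exp_grad_cont : {for (xb, wb), continuous (grad_x phi)};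
  exp_shift : forall e, 0 < e -> \forall z \near (xb, wb),
    `|phi z - phi (z.1, wb)| <= C * `|z.2 - wb| + e * `|z.1 - xb| ^+ 2;
  exp_grad_shift : forall e, 0 < e -> \forall z \near (xb, wb),
    `|grad_x phi z - grad_x phi (z.1, wb)|
      <= C * `|z.2 - wb| + e * `|z.1 - xb|;
  exp_trapezoid : forall e, 0 < e -> \forall x \near xb,
    `|phi (x, wb) - phi (xb, wb)
      - 2^-1 * dotp (grad_x phi (x, wb) + grad_x phi (xb, wb)) (x - xb)|
      <= e * `|x - xb| ^+ 2;
  exp_first_order : \forall x \near xb,
    `|phi (x, wb) - phi (xb, wb) - dotp (grad_x phi (x, wb)) (x - xb)|
      <= C * `|x - xb| ^+ 2;
  exp_lipschitz : \forall z \near (xb, xb),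
    `|phi (z.1, wb) - phi (z.2, wb)| <= C * `|z.1 - z.2|
}.

Section Smooth.
Variables (U0 : set 'rV[R]_n) (W0 : set 'rV[R]_s).
Variables (xb : 'rV[R]_n) (wb : 'rV[R]_s) (phi : 'rV[R]_n * 'rV[R]_s -> R).
Hypotheses (U0xb : nbhs xb U0) (W0wb : nbhs wb W0).
Hypothesis phi_smooth : partially_smooth U0 W0 xb wb phi.

(** Lipschitz continuity in the parameter is known at [xb] only.  Away from
[xb] the gradient difference moves by its derivative, a difference of two
Hessians near [(xb, wb)], which is small. *)
Lemma smooth_grad_shift : exists2 C, 0 <= C & forall e, 0 < e ->
  \forall z \near (xb, wb),
    `|grad_x phi z - grad_x phi (z.1, wb)|
      <= C * `|z.2 - wb| + e * `|z.1 - xb|.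
Proof.
have [C C0 lipC] := lipschitz_near_bound (ps_grad_lip phi_smooth).
exists C => // e e0.
(* The 2 pays for comparing both Hessians with the one at [(xb, wb)], and
   [n.+1], used instead of [n] to cover [n = 0], for the sum over coordinates. *)
pose e' := e / (n.+1%:R * 2).
have e'0 : 0 < e' by rewrite divr_gt0// mulr_gt0// ltr0n.
have /cvgrPdist_le/(_ e' e'0)/near_pair_radius[r1 r10 hessr] :=
  ps_hess_cont phi_smooth.
have /near_radius[r2 r20 U0r] := U0xb.
have W0wb' : W0 wb by exact: nbhs_singleton.
pose r := Num.min r1 r2.
have r0 : 0 < r by rewrite lt_min r10.
have W0near : \forall z \near (xb, wb), W0 z.2 by exact: near_snd.
have lipnear := near_snd xb lipC.
have rnear : \forall z \near (xb, wb), `|z.1 - xb| < r /\ `|z.2 - wb| < r.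
  by apply/near_pair_radius; exists r.
apply: filterS3 W0near lipnear rnear => -[x w] /= W0w lipw [xr wr].
pose theta i y := grad_x phi (y, w) 0 i - grad_x phi (y, wb) 0 i.
have thetaxb i : `|theta i xb| <= C * `|w - wb|.
  by apply: le_trans lipw; exact: coordB_le_norm.
have dtheta i : `|theta i x - theta i xb| <= n%:R * (e' * 2 * `|x - xb|).
  rewrite -{1}(subrKC xb x); apply: mvt_bound => a a01.
  set y := xb + _.
  have yr : `|y - xb| < r by apply: le_lt_trans xr; exact: norm_segment.
  have U0y : U0 y by apply: U0r; rewrite (lt_le_trans yr)// ge_min lexx orbT.
  have dg w' : W0 w' -> differentiable (fun y => grad_x phi (y, w') 0 i) y.
    by move=> W0w'; apply: differentiable_row_coord; exact: (ps_diff2 phi_smooth).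
  have dgw := dg w W0w; have dgwb := dg wb W0wb'.
  split=> [|j]; first exact: differentiableB.
  have hessE w' : `|w' - wb| < r ->
      `|hess_x phi (xb, wb) i j - hess_x phi (y, w') i j| <= e'.
    move=> w'r; have := hessr y w'.
    rewrite (lt_le_trans yr) ?ge_min ?lexx// (lt_le_trans w'r) ?ge_min ?lexx//.
    by move=> /(_ isT isT); apply: le_trans; exact: coordB_le_norm.
  have hw := hessE w wr; have hwb := hessE wb.
  rewrite subrr normr0 in hwb; have {}hwb := hwb r0.
  rewrite deriveB; [|exact: diff_derivable..].
  have derivE w' : 'D_(delta_mx 0 j) (fun y => grad_x phi (y, w') 0 i) y
      = hess_x phi (y, w') i j by rewrite [RHS]mxE.
  rewrite !derivE.
  rewrite mulr2n mulrDr mulr1.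
  apply: (le_trans _ (lerD hw hwb)); rewrite -[X in _ <= X + _]normrN.
  by apply: le_trans (ler_normD _ _); rewrite opprB addrA subrK.
apply: norm_le_coord => [|i j]; first by rewrite addr_ge0// mulr_ge0// ltW.
have -> : (grad_x phi (x, w) - grad_x phi (x, wb)) i j = theta j x.
  by rewrite ord1 mxE [X in _ + X]mxE.
rewrite -[theta j x](subrKC (theta j xb)).
apply: (le_trans (ler_normD _ _)); apply: lerD; first exact: thetaxb.
apply: (le_trans (dtheta j)); rewrite mulrA ler_wpM2r//.
have -> : n%:R * (e' * 2) = e * (n%:R / n.+1%:R).
  by rewrite /e'; field; rewrite ?pnatr_eq0// !natrS.
by rewrite ler_piMr ?(ltW e0)// ler_pdivrMr ?ltr0n// mul1r ler_nat.
Qed.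

(** One more integration of the previous estimate from [xb] to [x]. *)
Lemma smooth_shift : exists2 C, 0 <= C & forall e, 0 < e ->
  \forall z \near (xb, wb),
    `|phi z - phi (z.1, wb)| <= C * `|z.2 - wb| + e * `|z.1 - xb| ^+ 2.
Proof.
have [C C0 gradC] := smooth_grad_shift.
have [C1 C10 lipC1] := lipschitz_near_bound (ps_lip phi_smooth).
exists (C1 + n%:R * C) => [|e e0]; first by rewrite addr_ge0// mulr_ge0.
pose e' := e / n.+1%:R.
have e'0 : 0 < e' by rewrite divr_gt0// ltr0n.
have /near_pair_radius[r1 r10 gradr] := gradC e' e'0.
have /near_radius[r2 r20 U0r] := U0xb.
have W0wb' : W0 wb by exact: nbhs_singleton.
pose r := Num.min 1 (Num.min r1 r2).
have r0 : 0 < r by rewrite !lt_min ltr01 r10.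
have W0near : \forall z \near (xb, wb), W0 z.2 by exact: near_snd.
have lipnear := near_snd xb lipC1.
have rnear : \forall z \near (xb, wb), `|z.1 - xb| < r /\ `|z.2 - wb| < r.
  by apply/near_pair_radius; exists r.
apply: filterS3 W0near lipnear rnear => -[x w] /= W0w lipw.
rewrite !lt_min => -[/and3P[x1 xr1 xr2] /and3P[w1 wr1 wr2]].
pose theta y := phi (y, w) - phi (y, wb).
pose M := C * `|w - wb| + e' * `|x - xb|.
have dtheta : `|theta x - theta xb| <= n%:R * (M * `|x - xb|).
  rewrite -{1}(subrKC xb x); apply: mvt_bound => a a01.
  set y := xb + _.
  have yx : `|y - xb| <= `|x - xb| by exact: norm_segment.
  have U0y : U0 y by apply: U0r; exact: le_lt_trans xr2.
  have dphi w' : W0 w' -> differentiable (fun y => phi (y, w')) y.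
    by move=> W0w'; exact: (ps_diff phi_smooth).
  split=> [|j]; first by apply: differentiableB; exact: dphi.
  rewrite deriveB; [|exact/diff_derivable/dphi..].
  have := gradr y w (le_lt_trans yx xr1) wr1.
  move=> /(le_trans (coordB_le_norm _ _ 0 j)); rewrite !mxE /= => gradj.
  by apply: (le_trans gradj); rewrite /M lerD2l ler_wpM2l// ltW.
rewrite -/(theta x) -[theta x](subrKC (theta xb)).
apply: (le_trans (ler_normD _ _)).
apply: (le_trans (lerD lipw dtheta)).
rewrite [in leRHS]mulrDl -addrA lerD2l /M.
have -> : n%:R * ((C * `|w - wb| + e' * `|x - xb|) * `|x - xb|) =
  `|x - xb| * (n%:R * C * `|w - wb|) + n%:R * e' * `|x - xb| ^+ 2 by ring.
apply: lerD; first by rewrite ler_piMl ?(ltW x1)// !mulr_ge0.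
rewrite ler_wpM2r ?exprn_ge0//.
rewrite /e' mulrCA ler_piMr ?(ltW e0)// ler_pdivrMr ?ltr0n// mul1r ler_nat//.
Qed.

(** The error of the trapezoid rule is usually estimated with third
derivatives.  Here only [o(t^2)] is wanted, and differentiability of the
gradient at [xb] suffices: after subtracting the quadratic model, the derivative
[err] of the rest along the segment is [o(t^2)]. *)
Lemma smooth_trapezoid : forall e, 0 < e -> \forall x \near xb,
    `|phi (x, wb) - phi (xb, wb)
      - 2^-1 * dotp (grad_x phi (x, wb) + grad_x phi (xb, wb)) (x - xb)|
      <= e * `|x - xb| ^+ 2.
Proof.
move=> e e0.
pose e' := e / (n.+1%:R * 2).
have e'0 : 0 < e' by rewrite divr_gt0// mulr_gt0// ltr0n.
have U0xb' : U0 xb by exact: nbhs_singleton.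
have W0wb' : W0 wb by exact: nbhs_singleton.
pose G y := grad_x phi (y, wb).
have dG : differentiable G xb by exact: (ps_diff2 phi_smooth).
have /near_radius[r1 r10 Gr] := diff_eps dG e'0.
have /near_radius[r2 r20 U0r] := U0xb.
apply/near_radius; exists (Num.min r1 r2); first by rewrite lt_min r10.
move=> x; rewrite lt_min => /andP[xr1 xr2].
set u := x - xb in xr1 xr2 *.
pose err (t : R) := dotp (G (xb + t *: u) - G xb - t *: 'D_u G xb) u.
have errE t : 0 <= t <= 1 -> `|err t| <= n%:R * e' * `|u| ^+ 2.
  move=> t01; have tu : `|xb + t *: u - xb| <= `|u| by exact: norm_segment.
  apply: (le_trans (dotp_le _ _)); rewrite -mulrA ler_wpM2l// expr2 mulrA.
  rewrite ler_wpM2r//.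
  have := Gr (xb + t *: u) (le_lt_trans tu xr1).
  rewrite {2}[xb + _]addrC addrK !(deriveE _ dG) linearZ /=.
  by move=> /le_trans; apply; rewrite ler_wpM2l// ltW.
pose a := dotp (G xb) u; pose b := dotp ('D_u G xb) u.
pose chi (t : R) := phi (xb + t *: u, wb) - (t * a + t ^+ 2 * (b / 2)).
have errD t : err t = dotp (G (xb + t *: u)) u - a - t * b.
  by rewrite /err !dotpBl dotpZl.
have dchi (t : R) : 0 <= t <= 1 -> is_derive t 1 chi (err t).
  move=> t01.
  have xt : differentiable (fun y => phi (y, wb)) (xb + t *: u).
    apply: (ps_diff phi_smooth) => //; apply: U0r; apply: le_lt_trans xr2.
    exact: norm_segment.
  have dl := derive_line xt; rewrite derive_grad_x// in dl.
  rewrite errD -addrA -opprD; apply: is_deriveB.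
  apply: is_derive_eq.
  by rewrite /GRing.scale /= !mulr0 mulr1; field.
have [|t||t] := @MVT_segment R chi err 0 1.
- exact: ler01.
- by rewrite in_itv /= => /andP[t0 t1]; apply: dchi; rewrite !ltW.
- by apply: derivable_within_continuous => t; rewrite in_itv /= => /dchi[].
rewrite in_itv /= => /errE errt.
rewrite /chi scale0r scale1r addr0 subrKC => chiE.
have err1 := errE 1; rewrite lexx ler01 in err1; have {}err1 := err1 isT.
have -> : phi (x, wb) - phi (xb, wb) - 2^-1 * dotp (G x + G xb) u
    = err t - 2^-1 * err 1.
  have := errD 1; rewrite scale1r subrKC dotpDl -/a => errD1.
  by rewrite errD1; move: chiE; lra.
apply: (le_trans (ler_normB _ _)); rewrite normrM (@ger0_norm _ 2^-1)//.
have ne' : n%:R * e' <= e / 2.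
  have -> : n%:R * e' = e / 2 * (n%:R / n.+1%:R).
    by rewrite /e'; field; rewrite ?pnatr_eq0// !natrS.
  rewrite ler_piMr ?divr_ge0 ?(ltW e0)//.
  by rewrite ler_pdivrMr ?ltr0n// mul1r ler_nat.
have := ler_wpM2r (sqr_ge0 `|u|) ne'; move: errt err1.
by have := sqr_ge0 `|u|; have := mulr_ge0 (ltW e0) (sqr_ge0 `|u|); lra.
Qed.

Lemma smooth_grad_bound : exists2 C, 0 <= C &
  \forall x \near xb, `|grad_x phi (x, wb) - grad_x phi (xb, wb)|
    <= C * `|x - xb|.
Proof.
have W0wb' : W0 wb by exact: nbhs_singleton.
have U0xb' : U0 xb by exact: nbhs_singleton.
have dG := ps_diff2 phi_smooth U0xb' W0wb'.
have [C C0 dC] : exists2 C, 0 <= C & forall u,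
    `|'D_u (fun y => grad_x phi (y, wb)) xb| <= C * `|u|.
  have [C /= C0 dC] := linear_lipschitz (diff_continuous dG).
  by exists C => [|u]; [exact: ltW|rewrite deriveE].
exists (C + 1); first by rewrite addr_ge0.
have near1 := diff_eps dG ltr01.
apply: filterS near1 => x; rewrite mul1r => near1.
rewrite mulrDl mul1r.
rewrite -[X in `|X| <= _](subrK ('D_(x - xb) (fun y => grad_x phi (y, wb)) xb)).
by apply: (le_trans (ler_normD _ _)); rewrite addrC lerD.
Qed.

Lemma smooth_first_order : exists2 C, 0 <= C & \forall x \near xb,
    `|phi (x, wb) - phi (xb, wb) - dotp (grad_x phi (x, wb)) (x - xb)|
      <= C * `|x - xb| ^+ 2.
Proof.
have [C C0 gradC] := smooth_grad_bound.
exists (1 + n%:R * C); first by rewrite addr_ge0// mulr_ge0.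
apply: filterS2 gradC (smooth_trapezoid ltr01) => x gradx trapx.
have dotu := dotp_le (grad_x phi (x, wb) - grad_x phi (xb, wb)) (x - xb).
have {}dotu := le_trans dotu (ler_wpM2l (ler0n _ _)
  (ler_wpM2r (normr_ge0 _) gradx)).
move: trapx dotu; rewrite dotpDl dotpBl -mulrA -expr2 !ler_norml mulrDl mul1r.
rewrite -mulrA; move=> /andP[a1 a2] /andP[b1 b2].
have pos := mulr_ge0 (ler0n R n) (mulr_ge0 C0 (sqr_ge0 `|x - xb|)).
by apply/andP; split; lra.
Qed.

Lemma smooth_lipschitz : exists2 C, 0 <= C & \forall z \near (xb, xb),
    `|phi (z.1, wb) - phi (z.2, wb)| <= C * `|z.1 - z.2|.
Proof.
have [C C0 /near_radius[r1 r10 gradC]] := smooth_grad_bound.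
have W0wb' : W0 wb by exact: nbhs_singleton.
have /near_radius[r2 r20 U0r] := U0xb.
pose M := `|grad_x phi (xb, wb)| + C.
exists (n%:R * M); first by rewrite mulr_ge0// addr_ge0.
apply/near_pair_radius; exists (Num.min 1 (Num.min r1 r2)).
  by rewrite !lt_min ltr01 r10.
move=> x y /= xr yr; rewrite -[in leLHS](subrKC y x) -mulrA.
apply: (@mvt_bound _ _ (fun y => phi (y, wb))) => a a01; have := ball_segment a01 yr xr.
set z := y + _; rewrite !lt_min => /and3P[z1 zr1 zr2].
have dphi : differentiable (fun y => phi (y, wb)) z.
  by apply: (ps_diff phi_smooth) => //; exact: U0r.
split=> // j; rewrite derive_grad_x// dotp_delta.
apply: (le_trans (coord_le_norm _ _ _)).
rewrite -[grad_x _ _](subrKC (grad_x phi (xb, wb))).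
apply: (le_trans (ler_normD _ _)); rewrite lerD2l.
by apply: (le_trans (gradC _ zr1)); rewrite ler_piMr// ltW.
Qed.

Lemma smooth_expansion : exists2 C, 0 <= C & expansion C xb wb phi.
Proof.
have [C1 C10 P1] := smooth_shift.
have [C2 C20 P2] := smooth_grad_shift.
have [C3 C30 P3] := smooth_first_order.
have [C4 C40 P4] := smooth_lipschitz.
exists (C1 + C2 + C3 + C4); first by rewrite !addr_ge0.
have dphi : \forall z \near (xb, wb),
    differentiable (fun y => phi (y, z.2)) z.1.
  apply: filterS2 (near_fst wb U0xb) (near_snd xb W0wb) => -[x w] /=.
  exact: (ps_diff phi_smooth).
split; [exact: dphi|exact: ps_grad_cont phi_smooth|..].
- move=> e /P1; apply: filterS => z /le_trans; apply.
  by rewrite lerD2r ler_wpM2r// -!addrA lerDl !addr_ge0.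
- move=> e /P2; apply: filterS => z /le_trans; apply.
  by rewrite lerD2r ler_wpM2r// [C1 + _]addrC -!addrA lerDl !addr_ge0.
- exact: smooth_trapezoid.
- apply: filterS P3 => z /le_trans; apply.
  by rewrite ler_wpM2r// addrAC lerDr !addr_ge0.
- apply: filterS P4 => z /le_trans; apply.
  by rewrite ler_wpM2r// lerDr !addr_ge0.
Qed.

End Smooth.

Lemma expansionW C C' xb wb phi : C <= C' ->
  expansion C xb wb phi -> expansion C' xb wb phi.
Proof.
move=> CC' [P1 P2 P3 P4 P5 P6 P7]; split=> //.
- move=> e /P3; apply: filterS => z /le_trans; apply.
  by rewrite lerD2r ler_wpM2r.
- move=> e /P4; apply: filterS => z /le_trans; apply.
  by rewrite lerD2r ler_wpM2r.
- by apply: filterS P6 => z /le_trans; apply; rewrite ler_wpM2r.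
- by apply: filterS P7 => z /le_trans; apply; rewrite ler_wpM2r.
Qed.

End Estimates.

(** * Continuity, compactness and one-sided minima *)

Section Tools.
Context {R : realType}.

Lemma sum_continuous {T : topologicalType} m (F : 'I_m -> T -> R) :
  (forall k, continuous (F k)) -> continuous (fun z => \sum_k F k z).
Proof.
move=> cF; have -> : (fun z => \sum_k F k z) = \sum_k F k.
  by apply/funext => z; rewrite fct_sumE.
elim/big_ind : _ => [|f g cf cg|k _]; last exact: cF.
  by move=> x; exact: cvg_cst.
by move=> x; apply: continuousD; [exact: cf|exact: cg].
Qed.

Lemma enorm_continuous m : continuous (@enorm R m).
Proof.
move=> x; apply: (@continuous_comp _ _ _ _ (@Num.sqrt R)).
  apply: sum_continuous => i y.
  apply: (@continuous_comp _ _ _ (fun y : 'rV[R]_m => y 0 i) (fun a : R => a ^+ 2)).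
    exact: coord_continuous.
  exact: exprn_continuous.
exact: sqrt_continuous.
Qed.

Lemma slice_continuous {V W : topologicalType} (w : W) :
  continuous (fun y : V => (y, w)).
Proof. by move=> y; apply: cvg_pair => /=; [exact: cvg_id|exact: cvg_cst]. Qed.

Lemma dist_continuous {V : normedModType R} (c : V) :
  continuous (fun y : V => `|y - c|).
Proof.
move=> y; apply: (@continuous_comp _ _ _ (fun y => y - c)).
  by apply: continuousB; [exact: cvg_id|exact: cst_continuous].
exact: norm_continuous.
Qed.

Lemma compact_norm_ball m (c : 'rV[R]_m) r :
  compact [set y | `|y - c| <= r].
Proof.
apply: bounded_closed_compact.
  exists (`|c| + r); split=> [|M Mr y /= yr]; first exact: num_real.
  rewrite -(subrKC c y) (le_trans (ler_normD _ _))// (le_trans _ (ltW Mr))//.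
  by rewrite lerD2l.
have dist_cont : continuous (fun y : 'rV[R]_m => `|y - c|).
  exact: dist_continuous.
rewrite (_ : [set y | _] = (fun y => `|y - c|) @^-1` [set a | a <= r])//.
by apply: closed_comp => [y _|]; [exact: dist_cont|exact: closed_le].
Qed.

Lemma near_line {V : normedModType R} (x v : V) (P : V -> Prop) :
  (\forall y \near x, P y) -> \forall t \near 0^'+, P (x + t *: v).
Proof.
move=> /near_radius[r r0 Pr]; near=> t.
have t0 : 0 < t by near: t; exact: nbhs_right_gt.
apply: Pr; rewrite addrC addKr normrZ gtr0_norm//.
have : t < r / (`|v| + 1).
  by near: t; apply: nbhs_right_lt; rewrite divr_gt0// ltr_wpDl.
rewrite ltr_pdivlMr ?ltr_wpDl// => /le_lt_trans; apply.
by rewrite ler_wpM2l ?(ltW t0)// lerDl.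
Unshelve. all: by end_near. Qed.

Lemma derive_ge0 (T : R -> R) (D : R) : is_derive (0 : R) 1 T D ->
  (\forall t \near 0^'+, T 0 <= T t) -> 0 <= D.
Proof.
move=> dT Tge0; rewrite leNgt; apply/negP => D0.
have dT' : differentiable T 0 by apply/derivable1_diffP; case: dT.
have e0 : 0 < - D / 2 by rewrite divr_gt0// oppr_gt0.
have Teps := near_line (1 : R^o) (diff_eps dT' e0).
suff /filter_ex[] : \forall t \near (0 : R)^'+, False by [].
near=> t.
have t0 : 0 < t by near: t; exact: nbhs_right_gt.
have Tt : T 0 <= T t by near: t.
have : `|T t - T 0 - t * D| <= - D / 2 * t.
  have -> : t * D = 'D_t T 0.
    by rewrite -[t in RHS]mulr1 deriveE// linearZ /= -deriveE// derive_val.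
  have : (fun t : R => `|T (0 + t *: (1 : R^o)) - T 0 -
    'D_(0 + t *: (1 : R^o) - 0) T 0| <= - D / 2 * `|0 + t *: (1 : R^o) - 0|) t.
    by near: t; exact: Teps.
  by rewrite /= add0r subr0 [t *: _]mulr1 (gtr0_norm t0).
rewrite ler_norml => /andP[_].
have : t * D < 0 by rewrite pmulr_rlt0.
rewrite ltNge; lra.
Unshelve. all: by end_near. Qed.

End Tools.

(** * Violation of a system of equalities and inequalities *)

Section Violation.
Context {R : realType} {m : nat}.
Variable eqs : pred 'I_m.

Definition viol (a : 'rV[R]_m) : 'rV[R]_m :=
  \row_k (if eqs k then a 0 k else Num.max (a 0 k) 0).

Definition sign_ok (l : 'rV[R]_m) := forall k, ~~ eqs k -> 0 <= l 0 k.

Lemma viol_sign_ok a : sign_ok (viol a).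
Proof. by move=> k /negbTE kE; rewrite mxE kE le_max lexx orbT. Qed.

(** The squared violation is bounded by its quadratic model although the
positive part is not differentiable at 0, so no case distinction on active
inequalities is needed when it is expanded. *)
Lemma viol_sqr_le (a b : 'rV[R]_m) k :
  viol b 0 k ^+ 2 <= viol a 0 k ^+ 2 + 2 * viol a 0 k * (b 0 k - a 0 k)
    + (b 0 k - a 0 k) ^+ 2.
Proof.
rewrite !mxE; case: ifP => _; first by rewrite le_eqVlt; apply/orP; left; apply/eqP; ring.
have := sqr_ge0 (b 0 k - a 0 k).
case: (leP (a 0 k) 0) => a0; case: (leP (b 0 k) 0) => b0.
- by rewrite !(expr0n, mul0r, mulr0, add0r).
- by move=> _; rewrite !(expr0n, mul0r, mulr0, add0r) /=; nra.
- by move=> _; rewrite !(expr0n, mul0r, mulr0, add0r) /=; nra.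
- by move=> _; nra.
Qed.

Lemma enorm_viol_le (a b : 'rV[R]_m) : viol a = 0 ->
  enorm (viol b) <= enorm (b - a).
Proof.
move=> a0; rewrite -ler_sqr ?nnegrE ?sqrtr_ge0// !sqr_enorm; apply: ler_sum => k _.
have := viol_sqr_le a b k; rewrite a0 !mxE mulr0 mul0r expr0n !add0r.
by rewrite !expr2.
Qed.

Lemma viol_lipschitz a b : `|viol a - viol b| <= `|a - b|.
Proof.
apply: norm_le_coord => // i k; rewrite ord1.
apply: le_trans (coordB_le_norm a b 0 k); rewrite !mxE.
case: ifP => // _; case: (leP (a 0 k) 0) => a0; case: (leP (b 0 k) 0) => b0;
  rewrite ?(subr0, subrr, normr0, sub0r, normrN)//.
- rewrite (gtr0_norm b0) distrC; apply: le_trans (ler_norm _); lra.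
- rewrite (gtr0_norm a0); apply: le_trans (ler_norm _); lra.
Qed.

Lemma viol_continuous : continuous (viol : 'rV[R]_m -> 'rV[R]_m).
Proof.
move=> a; have aF : Filter (nbhs (a : 'rV[R]_m)) := nbhs_filter _.
apply/(@cvgrPdist_le _ _ _ _ aF) => e e0.
have near_a : \forall b \near (a : 'rV[R]_m), `|viol a - viol b| <= e.
  apply/near_radius; exists e => // b ba.
  by rewrite (le_trans (viol_lipschitz _ _))// distrC ltW.
exact: near_a.
Qed.

End Violation.

(** * Metric regularity *)

Section System.
Context {R : realType} {n s m : nat}.
Variables (eqs : pred 'I_m) (q : 'rV[R]_n * 'rV[R]_s -> 'rV[R]_m).
Variables (xb : 'rV[R]_n) (wb : 'rV[R]_s) (C : R).
Hypothesis q_cont : continuous q.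
Hypothesis q_exp : forall k, expansion C xb wb (coordf q k).
Hypothesis q_feas : viol eqs (q (xb, wb)) = 0.

Definition resid (z : 'rV[R]_n * 'rV[R]_s) := enorm (viol eqs (q z)).

Lemma resid_ge0 z : 0 <= resid z. Proof. exact: sqrtr_ge0. Qed.

Lemma resid_continuous : continuous resid.
Proof.
move=> z; apply: (@continuous_comp _ _ _ (fun z => viol eqs (q z))).
  by apply: continuous_comp; [exact: q_cont|exact: viol_continuous].
exact: enorm_continuous.
Qed.

Lemma resid_eq0 z : resid z = 0 -> viol eqs (q z) = 0.
Proof.
move=> r0; apply/eqP; rewrite -normr_eq0 eq_le normr_ge0 andbT -r0.
exact: norm_le_enorm.
Qed.

Lemma jac_x_near e : 0 < e -> \forall z \near (xb, wb),
  `|jac_x q z - jac_x q (xb, wb)| <= e.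
Proof.
move=> e0.
have gradk : \forall z \near (xb, wb), forall k,
    `|grad_x (coordf q k) (xb, wb) - grad_x (coordf q k) z| <= e.
  apply: near_forall => k /=.
  by have /cvgrPdist_le := exp_grad_cont (q_exp k); exact.
apply: filterS gradk => z gradk; apply: norm_le_coord => [|k j]; first exact: ltW.
rewrite mxE [X in _ + X]mxE /jac_x [X in X - _]mxE [X in _ - X]mxE distrC.
exact: le_trans (coordB_le_norm _ _ 0 j) (gradk k).
Qed.

Definition supported (l : 'rV[R]_m) z := forall k, q z 0 k != 0 -> l 0 k = 0.

Lemma supported_near : \forall z \near (xb, wb), forall l,
  supported l z -> supported l (xb, wb).
Proof.
have nz : \forall z \near (xb, wb), forall k,
    q (xb, wb) 0 k != 0 -> q z 0 k != 0.
  apply: near_forall => k /=.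
  have [qk0|qk0] := eqVneq (q (xb, wb) 0 k) 0.
    by apply: near_always => z /negP[]; exact/eqP.
  have /cvgr_neq0 : (fun z => q z 0 k) @ (xb, wb) --> q (xb, wb) 0 k.
    apply: (@continuous_comp _ _ _ q (fun a : 'rV[R]_m => a 0 k)).
      exact: q_cont.
    exact: coord_continuous.
  by move=> /(_ qk0); apply: filterS.
by apply: filterS nz => z nz l lz k /nz; exact: lz.
Qed.

(** Near [(xb, wb)] only constraints active there can be violated, so the
violation is itself an admissible multiplier. *)
Lemma viol_supported_near : \forall z \near (xb, wb),
  supported (viol eqs (q z)) (xb, wb).
Proof.
apply: near_forall => k /=.
have [qk0|qk0] := eqVneq (q (xb, wb) 0 k) 0.
    by apply: near_always => z /negP[]; exact/eqP.
have := congr1 (fun a : 'rV[R]_m => a 0 k) q_feas; rewrite !mxE.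
case: ifP => [_ /eqP|ek /eqP]; first by rewrite (negbTE qk0).
rewrite -[X in _ == X -> _]/(0 : R) => qk.
have {}qk : q (xb, wb) 0 k < 0.
  rewrite lt_neqAle qk0 /= leNgt; apply/negP => qpos.
  by move: qk; rewrite max_l ?(negbTE qk0)// ltW.
have /cvgr_lt : (fun z => q z 0 k) @ (xb, wb) --> q (xb, wb) 0 k.
  apply: (@continuous_comp _ _ _ q (fun a : 'rV[R]_m => a 0 k)).
    exact: q_cont.
  exact: coord_continuous.
move=> /(_ _ qk); apply: filterS => z qz _.
by rewrite mxE ek max_r// ltW.
Qed.

Lemma q_diff_near : \forall z \near (xb, wb), forall k,
  differentiable (fun y => q (y, z.2) 0 k) z.1.
Proof. by apply: near_forall => k; exact: exp_diff (q_exp k). Qed.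

(** [viol *m J] is half the gradient of the squared violation.  Thus the rate
of decrease of the violation along [v], if bounded by [b], bounds the slope of
its square. *)
Lemma resid_descent (v y : 'rV[R]_n) (w : 'rV[R]_s) (b : R) :
  (forall k, differentiable (fun y => q (y, w) 0 k) y) ->
  0 < resid (y, w) -> 0 <= b ->
  (\forall t \near 0^'+, resid (y, w) - b * t <= resid (y + t *: v, w)) ->
  - (b * resid (y, w)) <= dotp (viol eqs (q (y, w)) *m jac_x q (y, w)) v.
Proof.
move=> dq phi0 b0 descent.
have y0 : y + (0 : R) *: v = y by rewrite scale0r addr0.
pose l' := viol eqs (q (y, w)); pose phi := resid (y, w).
pose dqk k (t : R) := q (y + t *: v, w) 0 k - q (y, w) 0 k.
pose H k (t : R) := 2 * l' 0 k * dqk k t + dqk k t ^+ 2.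
(* [T] vanishes at 0 and, by the assumed bound on the decrease, is nonnegative
   for small positive [t]. *)
pose T := \sum_k H k + (fun t => t * (2 * b * phi)).
have dH k : is_derive (0 : R) 1 (H k) (2 * (l' 0 k * dotp (row k (jac_x q (y, w))) v)).
  have dl := @derive_line _ _ (fun y => q (y, w) 0 k) y v 0.
  rewrite y0 in dl; have {}dl := dl (dq k).
  have -> : row k (jac_x q (y, w)) = grad_x (coordf q k) (y, w) by rewrite rowK.
  rewrite (@derive_grad_x _ _ _ (coordf q k)) in dl; last exact: dq.
  apply: is_derive_eq.
  rewrite /dqk y0 subrr /GRing.scale /=; ring.
have dT : is_derive (0 : R) 1 T (\sum_k 2 * (l' 0 k * dotp (row k (jac_x q (y, w))) v) + 2 * b * phi).
  apply: is_deriveD; apply: is_derive_eq; rewrite /GRing.scale /=; ring.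
have TE t : T t = \sum_k H k t + t * (2 * b * phi).
  by rewrite /T fctE fct_sumE.
have T0 : T 0 = 0.
  rewrite TE mul0r addr0 big1// => k _; rewrite /H /dqk y0 subrr; ring.
have := derive_ge0 dT; rewrite -mulr_sumr -dotp_mulmx.
rewrite -/l' -/phi => Tge0.
suff : 0 <= 2 * dotp (l' *m jac_x q (y, w)) v + 2 * b * phi by nra.
apply: Tge0; rewrite T0; near=> t.
have t0 : 0 < t by near: t; exact: nbhs_right_gt.
have bt : b * t <= phi.
  have : t < phi / (b + 1).
    by near: t; apply: nbhs_right_lt; rewrite divr_gt0// ltr_wpDl.
  rewrite ltr_pdivlMr ?ltr_wpDl// mulrDr mulr1; rewrite mulrC; lra.
have : phi - b * t <= resid (y + t *: v, w) by near: t.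
rewrite -ler_sqr ?nnegrE ?subr_ge0 ?resid_ge0// [in leRHS]/resid sqr_enorm => le1.
have : dotp (viol eqs (q (y + t *: v, w))) (viol eqs (q (y + t *: v, w)))
    <= phi ^+ 2 + \sum_k H k t.
  rewrite /phi /resid sqr_enorm -big_split /=; apply: ler_sum => k _.
  by rewrite -!expr2 /H addrA; exact: viol_sqr_le.
move=> /(le_trans le1); rewrite TE.
have := sqr_ge0 (b * t); nra.
Unshelve. all: by end_near. Qed.

Section Qualified.
Variable kappa : R.
Hypothesis kappa0 : 0 < kappa.
Hypothesis pos_indep : forall l, sign_ok eqs l -> supported l (xb, wb) ->
  kappa * `|l| <= `|l *m jac_x q (xb, wb)|.

Lemma pos_indep_near : \forall z \near (xb, wb), forall l,
  sign_ok eqs l -> supported l (xb, wb) ->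
  kappa / 2 * `|l| <= `|l *m jac_x q z|.
Proof.
have e0 : 0 < kappa / 2 / m.+1%:R by rewrite !divr_gt0// ltr0n.
apply: filterS (jac_x_near e0) => z jacz l lsgn lsup.
have := pos_indep lsgn lsup.
have -> : l *m jac_x q (xb, wb) =
    l *m jac_x q z - l *m (jac_x q z - jac_x q (xb, wb)).
  by rewrite mulmxBr opprB addrC subrK.
move=> /le_trans/(_ (ler_normB _ _)).
have : `|l *m (jac_x q z - jac_x q (xb, wb))| <= kappa / 2 * `|l|.
  apply: (le_trans (mulmx_norm_le _ _)).
  apply: (le_trans (ler_wpM2l (ler0n _ _) (ler_wpM2l (normr_ge0 _) jacz))).
  have -> : m%:R * (`|l| * (kappa / 2 / m.+1%:R))
    = (kappa / 2 * `|l|) * (m%:R / m.+1%:R).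
    by field; rewrite ?pnatr_eq0// !natrS.
  rewrite ler_piMr// ?mulr_ge0 ?divr_ge0 ?(ltW kappa0)//.
  by rewrite ler_pdivrMr ?ltr0n// mul1r ler_nat.
lra.
Qed.

(** The point [y] minimizes the violation plus [c * |y - x|] over a ball.  If it
were infeasible, moving along [- g], where [g] is half the gradient of the
squared violation, would lower the violation faster than [c * |y - x|] grows. *)
Lemma metric_regularity : exists2 c, 0 < c & \forall z \near (xb, wb),
  exists2 y, viol eqs (q (y, z.2)) = 0 & c * `|y - z.1| <= resid z.
Proof.
have N0 : 0 < Num.sqrt m%:R + 1 :> R by rewrite ltr_wpDl// sqrtr_ge0.
(* [g] is at least [kappa / 2] times the sup norm of the violation, whose
   Euclidean norm is larger by a factor at most [sqrt m]. *)
pose c := kappa / 4 / (Num.sqrt m%:R + 1).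
have c0 : 0 < c by rewrite !divr_gt0.
have residb : resid (xb, wb) = 0.
  by rewrite /resid q_feas; apply/eqP; rewrite -sqrf_eq0 sqr_enorm dotp0l.
have good : \forall z \near (xb, wb), [/\
    forall k, differentiable (fun y => q (y, z.2) 0 k) z.1,
    forall l, sign_ok eqs l -> supported l (xb, wb) ->
      kappa / 2 * `|l| <= `|l *m jac_x q z| &
    supported (viol eqs (q z)) (xb, wb)].
  apply: filterS3 q_diff_near pos_indep_near viol_supported_near => z.
  by split.
have /near_pair_radius[r r0 goodr] := good.
exists c => //.
pose rho := r / 2; have rho0 : 0 < rho by rewrite divr_gt0.
have crho0 : 0 < c * (rho / 2) by rewrite mulr_gt0// divr_gt0.
have small : \forall z \near (xb, wb), resid z < c * (rho / 2).
  have := @resid_continuous (xb, wb); rewrite /continuous_at residb.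
  by move=> /cvgr_lt/(_ _ crho0).
have close : \forall z \near (xb, wb), `|z.1 - xb| < rho / 2 /\ `|z.2 - wb| < r.
  apply/near_pair_radius; exists (Num.min (rho / 2) r).
    by rewrite lt_min r0 divr_gt0.
  by move=> x w /=; rewrite !lt_min => /andP[-> _] /andP[_ ->].
apply: filterS2 small close => -[x w] /= xsmall [xr wr].
pose F y := resid (y, w) + c * `|y - x|.
pose K : set 'rV[R]_n := [set y | `|y - xb| <= rho].
have Kx : K x by rewrite /K /= (le_trans (ltW xr))// ler_pdivrMr// ler_pMr// ler1n.
have F_cont : continuous F.
  have c1 : continuous (fun y : 'rV[R]_n => resid (y, w)).
    move=> y; apply: (@continuous_comp _ _ _ (fun y => (y, w)) resid).
      exact: slice_continuous.
    exact: resid_continuous.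
  have c2 : continuous (fun y : 'rV[R]_n => `|y - x|) by exact: dist_continuous.
  move=> y; apply: (continuousD (c1 y)).
  by apply: continuousM; [exact: cst_continuous|exact: c2].
have [||y Ky Fmin] := @EVT_min_rV R n F K _ (@compact_norm_ball R n xb rho).
- by exists x.
- exact: continuous_subspaceT.
have {}Fmin y' : K y' -> F y <= F y' by move=> Ky'; apply: Fmin; rewrite inE.
have yx : c * `|y - x| <= resid (x, w).
  have := Fmin x Kx; rewrite /F subrr normr0 mulr0 addr0.
  by apply: le_trans; rewrite lerDr resid_ge0.
have yrho : `|y - xb| < rho.
  rewrite -(subrKA x) (le_lt_trans (ler_normD _ _))//.
  have : `|y - x| < rho / 2 by rewrite -(ltr_pM2l c0) (le_lt_trans yx).
  by move: xr; lra.
exists y; last by [].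
apply: resid_eq0; apply/eqP; rewrite eq_le resid_ge0 andbT leNgt; apply/negP => phi0.
have yr : `|y - xb| < r by rewrite (lt_trans yrho)// ltr_pdivrMr// ltr_pMr// ltr1n.
have [/= dq pi_l sup_l] := goodr y w yr wr.
set l := viol eqs (q (y, w)) in sup_l.
pose g := l *m jac_x q (y, w).
have lg : kappa / 2 * `|l| <= `|g| by apply: pi_l => //; exact: viol_sign_ok.
have phil : resid (y, w) <= Num.sqrt m%:R * `|l| by exact: enorm_le_norm.
have l0 : 0 < `|l|.
  rewrite lt_neqAle normr_ge0 andbT; apply/eqP => l0.
  by move: phil; rewrite -l0 mulr0 leNgt phi0.
have g0 : 0 < `|g| by rewrite (lt_le_trans _ lg)// mulr_gt0// divr_gt0.
have cg0 : 0 <= c * `|g| by rewrite mulr_ge0// ltW.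
have := resid_descent (v := - g) dq phi0 cg0.
rewrite -/l -/g dotpNr lerN2 => desc.
have {}desc : dotp g g <= c * `|g| * resid (y, w).
  apply: desc; near=> t.
  have t0 : 0 < t by near: t; exact: nbhs_right_gt.
  have Kt : K (y + t *: - g).
    near: t; apply: (@near_line _ _ _ _ K); apply/near_radius.
    exists (rho - `|y - xb|); first by rewrite subr_gt0.
    move=> y' y'y; rewrite /K /= -(subrKA y) (le_trans (ler_normD _ _))//.
    by move: y'y; lra.
  have := Fmin _ Kt; rewrite /F.
  have : `|y + t *: - g - x| <= `|y - x| + t * `|g|.
    rewrite addrAC (le_trans (ler_normD _ _))// normrZ normrN gtr0_norm//.
  move=> /(ler_wpM2l (ltW c0)); lra.
have := le_trans (sqr_norm_le_dotp g) desc.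
rewrite expr2 mulrAC ler_pM2r// => gc.
have : c * resid (y, w) <= kappa / 4 * `|l|.
  apply: (le_trans (ler_wpM2l (ltW c0) phil)).
  rewrite mulrA ler_wpM2r// /c mulrAC ler_pdivrMr//.
  by rewrite ler_wpM2l ?divr_ge0 ?(ltW kappa0)// lerDl.
have : 0 < kappa * `|l| by rewrite mulr_gt0.
move: lg gc; lra.
Unshelve. all: by end_near. Qed.

End Qualified.
End System.

(** * Stationarity and multipliers *)

Section NormalCone.
Context {R : realType} {n : nat}.

Lemma regular_normal_coneP (G : set 'rV[R]_n) x xi : G x ->
  regular_normal_cone G x xi <->
  forall e, 0 < e -> \forall y \near x, G y ->
    dotp xi (y - x) <= e * enorm (y - x).
Proof.
move=> Gx; split=> [[_ +] e e0|xiP].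
  rewrite limf_esupE => inf0.
  have : (ereal_inf [set ereal_sup ((fun x' : 'rV[R]_n =>
    (dotp xi (x' - x) / enorm (x' - x))%:E) @` V) | V in within G x^'] < e%:E)%E.
    by rewrite (le_lt_trans inf0)// lte_fin.
  move=> /ereal_inf_lt[_ [V GV <-] supV].
  move: GV; rewrite /within /= => /nbhs_normP[r /= r0 rV].
  apply/near_radius; exists r => // y yx Gy.
  have [->|yneq] := eqVneq y x; first by rewrite subrr dotpC dotp0l mulr_ge0// ?(ltW e0) ?sqrtr_ge0.
  have Vy : V y by apply: rV => //=; rewrite distrC.
  have y0 : 0 < enorm (y - x).
    by rewrite (lt_le_trans _ (norm_le_enorm _))// normr_gt0 subr_eq0.
  have : ((dotp xi (y - x) / enorm (y - x))%:E < e%:E)%E.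
    by apply: le_lt_trans supV; apply: ereal_sup_ubound; exists y.
  by rewrite lte_fin ltr_pdivrMr// => /ltW.
split=> //; apply/lee_addgt0Pr => e e0; rewrite add0e limf_esupE.
pose V := [set y | [/\ y != x, G y & dotp xi (y - x) <= e * enorm (y - x)]].
have GV : within G x^' V.
  suff : \forall y \near x, y != x -> G y -> V y by [].
  by apply: filterS (xiP e e0) => y xiy yneq Gy; split=> //; exact: xiy.
apply: (@le_trans _ _ (ereal_sup ((fun x' : 'rV[R]_n =>
    (dotp xi (x' - x) / enorm (x' - x))%:E) @` V))).
  by apply: ereal_inf_lbound; exists V.
apply: ge_ereal_sup => _ [y [yneq Gy ley] <-]; rewrite lee_fin ler_pdivrMr//.
by rewrite (lt_le_trans _ (norm_le_enorm _))// normr_gt0 subr_eq0.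
Qed.

End NormalCone.

Section Multipliers.
Context {R : realType} {n s m : nat}.
Variables (eqs : pred 'I_m) (q : 'rV[R]_n * 'rV[R]_s -> 'rV[R]_m).
Local Notation feas w := [set y | viol eqs (q (y, w)) = 0].
Local Notation resid := (resid eqs q).

(** Linearized feasible directions are tangent: [x + t d] violates the
constraints by [o(t)] only, so metric regularity moves it to a feasible point at
distance [o(t)], to which normality of [xi] applies. *)
Lemma linearized_direction (x : 'rV[R]_n) (w : 'rV[R]_s) (xi d : 'rV[R]_n) c :
  0 < c ->
  (forall k, differentiable (fun y => q (y, w) 0 k) x) ->
  (\forall z \near (x, w), exists2 y,
    viol eqs (q (y, z.2)) = 0 & c * `|y - z.1| <= resid z) ->
  viol eqs (q (x, w)) = 0 ->
  (forall e, 0 < e -> \forall y \near x, feas w y ->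
    dotp xi (y - x) <= e * enorm (y - x)) ->
  (forall k, eqs k -> dotp (grad_x (coordf q k) (x, w)) d = 0) ->
  (forall k, q (x, w) 0 k = 0 -> dotp (grad_x (coordf q k) (x, w)) d <= 0) ->
  dotp xi d <= 0.
Proof.
move=> c0 dq regular xfeas xi_normal d_eq d_ineq.
pose sm : R := Num.sqrt m%:R; pose sn : R := Num.sqrt n%:R.
have sm0 : 0 <= sm := sqrtr_ge0 _; have sn0 : 0 <= sn := sqrtr_ge0 _.
pose a : R := sm / c * `|d|.
have a0 : 0 <= a by rewrite mulr_ge0// divr_ge0// ltW.
pose B := sn * (`|d| + a) + n%:R * `|xi| * a.
have B0 : 0 <= B by rewrite addr_ge0// mulr_ge0// ?addr_ge0// mulr_ge0.
suff dir e : 0 < e -> e <= 1 -> dotp xi d <= e * B.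
  rewrite leNgt; apply/negP => pos.
  pose e := Num.min 1 (dotp xi d / (2 * (B + 1))).
  have B1 : 0 < B + 1 by rewrite ltr_wpDl.
  have e0 : 0 < e by rewrite lt_min ltr01 divr_gt0// mulr_gt0.
  have e1 : e <= 1 by rewrite ge_min lexx.
  have : e <= dotp xi d / (2 * (B + 1)) by rewrite ge_min lexx orbT.
  rewrite ler_pdivlMr ?mulr_gt0//; have := dir e e0 e1.
  have := mulr_ge0 (ltW e0) B0; nra.
move=> e0 e1.
have lin_near : \forall y \near x, forall k,
    `|q (y, w) 0 k - q (x, w) 0 k - 'D_(y - x) (fun y => q (y, w) 0 k) x|
      <= e * `|y - x|.
  by apply: near_forall => k; exact: diff_eps.
have neg_near : \forall t \near (0 : R)^'+, forall k, q (x, w) 0 k < 0 ->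
    q (x, w) 0 k + t * dotp (grad_x (coordf q k) (x, w)) d <= 0.
  apply: (@filter_forall _ _ (fun k t => q (x, w) 0 k < 0 ->
    q (x, w) 0 k + t * dotp (grad_x (coordf q k) (x, w)) d <= 0)) => k.
  set b := dotp _ _.
  have [qk|qk] := ltP (q (x, w) 0 k) 0; last by apply: nearW => t.
  near=> t => _.
  have t0 : 0 < t by near: t; exact: nbhs_right_gt.
  have : t < - q (x, w) 0 k / (`|b| + 1).
    by near: t; apply: nbhs_right_lt; rewrite divr_gt0 ?oppr_gt0// ltr_wpDl.
  rewrite ltr_pdivlMr ?ltr_wpDl//.
  have := ler_wpM2l (ltW t0) (ler_norm b); nra.
have xi_near := xi_normal e e0.
have /near_radius[rho rho0 xi_rho] := xi_near.
suff : \forall t \near (0 : R)^'+, t * dotp xi d <= t * (e * B).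
  move=> near_t; suff /filter_ex[t [t0]] : \forall t \near (0 : R)^'+,
    0 < t /\ t * dotp xi d <= t * (e * B) by rewrite ler_pM2l.
  by near=> t; split; near: t; [exact: nbhs_right_gt|exact: near_t].
have lin_t := near_line d lin_near.
have reg_t := near_line d (near_slice regular).
near=> t.
have t0 : 0 < t by near: t; exact: nbhs_right_gt.
have lint k : `|q (x + t *: d, w) 0 k - q (x, w) 0 k
    - t * dotp (grad_x (coordf q k) (x, w)) d| <= e * (t * `|d|).
  have : forall k, `|q (x + t *: d, w) 0 k - q (x, w) 0 k
    - 'D_(x + t *: d - x) (fun y => q (y, w) 0 k) x| <= e * `|x + t *: d - x|.
    by near: t; exact: lin_t.
  move=> /(_ k); rewrite [x + _ - x]addrAC subrr add0r normrZ gtr0_norm//.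
  by rewrite deriveE// linearZ /= -deriveE// -(@derive_grad_x _ _ _ (coordf q k))//; exact: dq.
have negt k : q (x, w) 0 k < 0 ->
    q (x, w) 0 k + t * dotp (grad_x (coordf q k) (x, w)) d <= 0.
  by move: k; near: t; exact: neg_near.
have [y yfeas /= yt] : exists2 y, viol eqs (q (y, w)) = 0 &
    c * `|y - (x + t *: d)| <= resid (x + t *: d, w).
  by near: t; exact: reg_t.
pose lin : 'rV[R]_m :=
  \row_k (q (x, w) 0 k + t * dotp (grad_x (coordf q k) (x, w)) d).
have xk k : eqs k && (q (x, w) 0 k == 0) || (~~ eqs k) && (q (x, w) 0 k <= 0).
  have := congr1 (fun a : 'rV[R]_m => a 0 k) xfeas; rewrite !mxE.
  case: (eqs k) => /= [->//|/eqP]; first by rewrite eqxx.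
  by rewrite -[X in _ == X -> _]/(0 : R) eq_maxr.
have lin0 : viol eqs lin = 0.
  apply/rowP => k; rewrite !mxE.
  have := xk k; case: ifP => /= [ek|ek]; rewrite ?orbF.
    by move=> /eqP ->; rewrite d_eq// mulr0 addr0.
  rewrite le_eqVlt => /orP[/eqP qk|qk]; apply: max_r; last exact: negt.
  by rewrite qk add0r mulr_ge0_le0 ?(ltW t0) ?d_ineq.
have residt : resid (x + t *: d, w) <= sm * (e * (t * `|d|)).
  apply: (le_trans (enorm_viol_le _ lin0)).
  apply: (le_trans (enorm_le_norm _)); rewrite ler_wpM2l//.
  apply: norm_le_coord => [|i k]; first by rewrite !mulr_ge0// ltW.
  by rewrite ord1 mxE [lin]lock mxE -lock mxE opprD addrA.
have ydist : `|y - (x + t *: d)| <= e * t * a.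
  rewrite /a mulrCA -(ler_pM2l c0) (le_trans yt)// (le_trans residt)//.
  by rewrite le_eqVlt; apply/orP; left; apply/eqP; field; rewrite gt_eqF.
have yx : `|y - x| <= t * (`|d| + a).
  have -> : y - x = (y - (x + t *: d)) + t *: d.
    by rewrite opprD addrA subrK.
  apply: (le_trans (ler_normD _ _)); rewrite normrZ gtr0_norm// mulrDr addrC.
  rewrite lerD2l (le_trans ydist)// ler_wpM2r//.
  by rewrite ler_piMl// ltW.
have yrho : `|y - x| < rho.
  apply: (le_lt_trans yx).
  have : t < rho / (`|d| + a + 1).
    by near: t; apply: nbhs_right_lt; rewrite divr_gt0// ltr_wpDl// addr_ge0.
  rewrite ltr_pdivlMr ?ltr_wpDl ?addr_ge0//; lra.
have xi_y : dotp xi (y - x) <= e * (sn * (t * (`|d| + a))).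
  apply: (le_trans (xi_rho y yrho yfeas)); rewrite ler_wpM2l ?(ltW e0)//.
  by apply: (le_trans (enorm_le_norm _)); rewrite ler_wpM2l.
have xi_corr : `|dotp xi (y - (x + t *: d))| <= n%:R * (`|xi| * (e * t * a)).
  by apply: (le_trans (dotp_le _ _)); rewrite !ler_wpM2l.
move: xi_corr; rewrite ler_norml => /andP[xi_corr _].
have : dotp xi (y - x) = dotp xi (y - (x + t *: d)) + t * dotp xi d.
  by rewrite -dotpZr -dotpDr opprD addrA subrK.
rewrite /B; move: xi_y xi_corr; lra.
Unshelve. all: by end_near. Qed.

Lemma sqr_affine_continuous (a : 'rV[R]_n) (J : 'M[R]_(m, n)) :
  continuous (fun l : 'rV[R]_m => dotp (a + l *m J) (a + l *m J)).
Proof.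
apply: sum_continuous => j.
have pj : continuous (fun l : 'rV[R]_m => (a + l *m J) 0 j).
  rewrite (_ : (fun l : 'rV[R]_m => (a + l *m J) 0 j) =
    fun l : 'rV[R]_m => a 0 j + \sum_k l 0 k * J k j).
    move=> l; apply: continuousD; first exact: cst_continuous.
    apply: sum_continuous => k l'; apply: continuousM; last exact: cst_continuous.
    exact: coord_continuous.
  by apply/funext => l; rewrite mxE; congr (_ + _); rewrite mxE.
by move=> l; apply: continuousM; exact: pj.
Qed.

Lemma closed_sign_ok : closed [set l : 'rV[R]_m | sign_ok eqs l].
Proof.
rewrite (_ : [set l : 'rV[R]_m | _] = \bigcap_(k in [set k | ~~ eqs k])
  ((fun l : 'rV[R]_m => l 0 k) @^-1` [set a | 0 <= a]));
  last by rewrite predeqE => l.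
apply: closed_bigI => k _; apply: closed_comp; last exact: closed_ge.
by move=> l _; exact: coord_continuous.
Qed.

Lemma closed_vanishing (P : pred 'I_m) :
  closed [set l : 'rV[R]_m | forall k, P k -> l 0 k = 0].
Proof.
rewrite (_ : [set l : 'rV[R]_m | _] = \bigcap_(k in [set k | P k])
  ((fun l : 'rV[R]_m => l 0 k) @^-1` [set a | a = 0]));
  last by rewrite predeqE => l.
apply: closed_bigI => k _; apply: closed_comp; last exact: closed_eq.
by move=> l _; exact: coord_continuous.
Qed.

(** Farkas' lemma in the form needed here.  Minimize the norm of
[p l = gradf + l *m J] over the admissible [l].  The optimality conditions say that
[- p l] is a linearized feasible direction orthogonal to [l *m J]; hence
[gradf] decreases along it at rate [|p l|^2], which stationarity forbids
unless [p l = 0].  Positive linear independence makes the problem coercive, so a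
minimizer exists and lies inside the ball of radius [B]. *)
Lemma projection_multiplier (z : 'rV[R]_n * 'rV[R]_s) (gradf : 'rV[R]_n) kappa :
  0 < kappa ->
  (forall l, sign_ok eqs l -> supported q l z ->
    kappa * `|l| <= `|l *m jac_x q z|) ->
  (forall d : 'rV[R]_n,
    (forall k, eqs k -> dotp (row k (jac_x q z)) d = 0) ->
    (forall k, q z 0 k = 0 -> dotp (row k (jac_x q z)) d <= 0) ->
    0 <= dotp gradf d) ->
  (forall k, eqs k -> q z 0 k = 0) ->
  exists l, [/\ sign_ok eqs l, supported q l z & gradf + l *m jac_x q z = 0].
Proof.
move=> kappa0 indep statio eqs_active.
set J := jac_x q z in indep statio *.
pose p (l : 'rV[R]_m) := gradf + l *m J.
pose B := 2 * enorm gradf / kappa + 1.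
have B0 : 0 <= B by rewrite addr_ge0// divr_ge0 ?(ltW kappa0)// mulr_ge0 ?sqrtr_ge0.
pose K : set 'rV[R]_m := [set l | sign_ok eqs l] `&` [set l | supported q l z]
  `&` [set l | `|l - 0| <= B].
have K_compact : compact K.
  apply: (subclosed_compact _ (@compact_norm_ball R m 0 B)); last by move=> l [].
  apply: closedI; first apply: closedI.
  - exact: closed_sign_ok.
  - by have := @closed_vanishing (fun k => q z 0 k != 0); exact.
  - exact: compact_closed (@norm_hausdorff _ _) (@compact_norm_ball R m 0 B).
pose Phi l := dotp (p l) (p l).
have Phi_cont : continuous Phi by exact: sqr_affine_continuous.
have K0 : K 0.
  by split; [split|] => [k _|k _|] /=; rewrite ?mxE// subr0 normr0.
have [||l Kl lmin] := @EVT_min_rV R m Phi K _ K_compact.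
- by exists 0.
- exact: continuous_subspaceT.
have {}lmin l' : K l' -> Phi l <= Phi l' by move=> Kl'; apply: lmin; rewrite inE.
have [[/= lsgn lsup] _] : K l by rewrite inE in Kl.
have lB : `|l| < B.
  have : enorm (p l) <= enorm gradf.
    rewrite -ler_sqr ?nnegrE ?sqrtr_ge0// !sqr_enorm.
    by have := lmin 0 K0; rewrite /Phi {3 4}/p mul0mx addr0.
  move=> /(le_trans (norm_le_enorm _)) pl.
  have := indep l lsgn lsup.
  have -> : l *m J = p l - gradf by rewrite /p addrC addKr.
  move=> /le_trans/(_ (ler_normB _ _)) kl.
  rewrite /B -ltrBlDr; apply: (@lt_le_trans _ _ `|l|); first by rewrite ltrBlDr ltrDl.
  rewrite ler_pdivlMr// mulrC (le_trans kl)// mulr_natl mulr2n lerD//.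
  exact: norm_le_enorm.
have first_order (a : 'rV[R]_m) :
    (\forall t \near (0 : R)^'+, sign_ok eqs (l + t *: a)) ->
    supported q a z -> 0 <= dotp (p l) (a *m J).
  move=> a_sgn a_sup.
  pose b := dotp (p l) (a *m J); pose c := dotp (a *m J) (a *m J).
  have PhiE t : Phi (l + t *: a) = Phi l + (t * (2 * b) + t ^+ 2 * c).
    have pE : p (l + t *: a) = p l + t *: (a *m J).
      by rewrite /p mulmxDl -scalemxAl addrA.
    rewrite /Phi pE /b /c; move: (p l) (a *m J) => u v.
    by rewrite !dotpDr !dotpDl !dotpZr !dotpZl (dotpC v u); ring.
  have := @derive_ge0 _ (fun t : R => t * (2 * b) + t ^+ 2 * c) (2 * b).
  rewrite pmulr_rge0//; apply.
    by apply: is_derive_eq; rewrite /GRing.scale /=; ring.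
  rewrite mul0r expr0n mul0r addr0.
  have lt_B := near_line a (iffRL (near_radius l (fun y => `|y - 0| <= B)) _).
  near=> t.
  rewrite -(lerD2l (Phi l)) addr0 -PhiE; apply: lmin; split; first split.
  - by near: t; exact: a_sgn.
  - by move=> k qk; rewrite !mxE lsup// a_sup// mulr0 addr0.
  - rewrite /=; near: t; apply: lt_B; exists (B - `|l|); first by rewrite subr_gt0.
    move=> l' l'l; rewrite subr0 -(subrKC l l') (le_trans (ler_normD _ _))//.
    by move: l'l; lra.
exists l; split=> //.
(* The admissible set is a cone: [l] can be shrunk as well as stretched. *)
have orth : dotp (p l) (l *m J) = 0.
  apply/eqP; rewrite eq_le; apply/andP; split.
    rewrite -oppr_ge0 -dotpNr -mulNmx; apply: first_order; last first.
      by move=> k qk; rewrite mxE lsup// oppr0.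
    near=> t => k ek.
    have t1 : t < 1 by near: t; exact: nbhs_right_lt.
    by rewrite !mxE mulrN -[X in X - _]mul1r -mulrBl mulr_ge0 ?subr_ge0 ?(ltW t1)// lsgn.
  apply: first_order => //; near=> t => k ek.
  have t0 : 0 < t by near: t; exact: nbhs_right_gt.
  by rewrite !mxE addr_ge0 ?lsgn// mulr_ge0 ?lsgn// ltW.
have active_ge0 k : q z 0 k = 0 -> 0 <= dotp (p l) (row k J).
  move=> qk; rewrite rowE; apply: first_order; last first.
    move=> k' qk'; rewrite mxE eqxx /=; case: eqP => //= kk'.
    by rewrite kk' qk eqxx in qk'.
  near=> t => k' ek'.
  have t0 : 0 < t by near: t; exact: nbhs_right_gt.
  by rewrite !mxE addr_ge0 ?lsgn// mulr_ge0 ?ler0n// ltW.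
have eq_eq0 k : eqs k -> dotp (p l) (row k J) = 0.
  move=> ek; have qk := eqs_active k ek.
  apply/eqP; rewrite eq_le active_ge0// andbT -oppr_ge0 -dotpNr rowE -mulNmx.
  apply: first_order; last first.
    move=> k' qk'; rewrite !mxE eqxx /=; case: eqP => [kk'|_]; last by rewrite oppr0.
    by rewrite kk' qk eqxx in qk'.
  near=> t => k' ek'.
  rewrite !mxE eqxx /=; case: eqP => [kk'|_] /=; first by rewrite kk' ek in ek'.
  by rewrite oppr0 mulr0 addr0 lsgn.
have grad_p : gradf = p l - l *m J by rewrite /p addrK.
rewrite -/(p l); have := statio (- p l); rewrite {1}grad_p.
move: (p l) orth active_ge0 eq_eq0 => r orth active_ge0 eq_eq0.
rewrite dotpBl !dotpNr (dotpC (l *m J)) orth !oppr0 addr0 oppr_ge0 => r_le0.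
apply/eqP; rewrite -normr_eq0 -sqrf_eq0 eq_le sqr_ge0 andbT.
apply: (le_trans (sqr_norm_le_dotp r)); apply: r_le0 => k.
  by move=> ek; rewrite dotpNr dotpC eq_eq0// oppr0.
by move=> qk; rewrite dotpNr dotpC oppr_le0 active_ge0.
Unshelve. all: by end_near. Qed.

End Multipliers.

(** * Growth against stationarity *)

(** The contribution of one constraint to the trapezoid rule for the Lagrangian
with multiplier [l']: [D] is the increment of the constraint, [a] and [b] are its
slopes at [(x, wb)] and [(xb, wb)], and [a'] is the slope at [(x, w)]. *)
Lemma multiplier_term_le {R : realType} (M B K Y l l' D a a' b : R) :
  0 <= M -> `|l| <= M -> `|l'| <= M ->
  `|D - 2^-1 * (a + b)| <= Y -> `|a - a'| <= K ->
  `|l' * D| <= M * B -> `|(l' - l) * a| <= 2 * B ->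
  l' * (D - 2^-1 * (a + b)) - l' * D + 2^-1 * (l * (a - a'))
    + 2^-1 * ((l' - l) * a) <= M * Y + M * B + M * K + B.
Proof.
move=> M0 lM l'M tr gs lD lG.
have le1 : l' * (D - 2^-1 * (a + b)) <= M * Y.
  by apply: le_trans (ler_norm _) _; rewrite normrM ler_pM.
have le2 : l * (a - a') <= M * K.
  by apply: le_trans (ler_norm _) _; rewrite normrM ler_pM.
have MK : 0 <= M * K by rewrite mulr_ge0// (le_trans _ gs).
move: lD lG; rewrite !ler_norml => /andP[lD _] /andP[_ lG]; lra.
Qed.

Section Program.
Context {R : realType} {n s m : nat}.
Variables (f : 'rV[R]_n * 'rV[R]_s -> R).
Variables (eqs : pred 'I_m) (q : 'rV[R]_n * 'rV[R]_s -> 'rV[R]_m).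
Variables (xb : 'rV[R]_n) (wb : 'rV[R]_s) (C kappa : R).
Hypothesis f_cont : continuous f.
Hypothesis q_cont : continuous q.
Hypothesis C0 : 0 <= C.
Hypothesis f_exp : expansion C xb wb f.
Hypothesis q_exp : forall k, expansion C xb wb (coordf q k).
Hypothesis q_feas : viol eqs (q (xb, wb)) = 0.
Hypothesis kappa0 : 0 < kappa.
Hypothesis pos_indep : forall l, sign_ok eqs l -> supported q l (xb, wb) ->
  kappa * `|l| <= `|l *m jac_x q (xb, wb)|.

Local Notation feas w := [set y | viol eqs (q (y, w)) = 0].

Definition program_stationary z :=
  regular_normal_cone (feas z.2) z.1 (- grad_x f z).

Lemma grad_near phi e : expansion C xb wb phi -> 0 < e ->
  \forall z \near (xb, wb), `|grad_x phi z - grad_x phi (xb, wb)| <= e.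
Proof.
move=> phi_exp e0; have /cvgrPdist_le/(_ e e0) := exp_grad_cont phi_exp.
by apply: filterS => z; rewrite distrC.
Qed.

Lemma stationary_multiplier : exists2 M, 0 <= M & \forall z \near (xb, wb),
  program_stationary z -> exists l, [/\ sign_ok eqs l, supported q l z,
    `|l| <= M & grad_x f z + l *m jac_x q z = 0].
Proof.
pose M := 2 / kappa * (`|grad_x f (xb, wb)| + 1).
have k20 : 0 < kappa / 2 by rewrite divr_gt0.
exists M; first by rewrite mulr_ge0 ?divr_ge0 ?addr_ge0// ltW.
have [c c0 regular] := metric_regularity q_cont q_exp q_feas kappa0 pos_indep.
have regular_near := near_near regular.
have indep_near := pos_indep_near q_exp kappa0 pos_indep.
have gradf_near := grad_near f_exp ltr01.
have near1 : \forall z \near (xb, wb), forall l, sign_ok eqs l ->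
    supported q l z -> kappa / 2 * `|l| <= `|l *m jac_x q z|.
  have := supported_near xb wb q_cont.
  apply: filterS2 indep_near => z zi zs l ls /zs; exact: zi.
have near2 : \forall z \near (xb, wb), (forall k,
    differentiable (fun y => q (y, z.2) 0 k) z.1) /\
    `|grad_x f z - grad_x f (xb, wb)| <= 1.
  by apply: filterS2 (q_diff_near q_exp) gradf_near => z.
apply: filterS3 regular_near near1 near2 => -[x w] /= reg indep [dq gradf] stat.
have xfeas : viol eqs (q (x, w)) = 0 by case: stat.
have [|k ek|l [lsgn lsup lmult]] := @projection_multiplier _ _ _ _ eqs q (x, w)
    (grad_x f (x, w)) (kappa / 2) k20 indep.
- move=> d d_eq d_ineq; rewrite -oppr_le0 -dotpNl.
  apply: (linearized_direction c0 dq reg xfeas).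
  + move=> e e0; exact: (iffLR (regular_normal_coneP _ xfeas) stat).
  + by move=> k ek; rewrite -(d_eq k ek) rowK.
  + by move=> k qk; have := d_ineq k qk; rewrite rowK.
- by have := congr1 (fun a : 'rV[R]_m => a 0 k) xfeas; rewrite !mxE ek.
exists l; split=> //.
have -> : M = (kappa / 2)^-1 * (`|grad_x f (xb, wb)| + 1) by rewrite invf_div.
rewrite ler_pdivlMl// (le_trans (indep l lsgn lsup))//.
have -> : l *m jac_x q (x, w) = - grad_x f (x, w).
  by apply/eqP; rewrite -addr_eq0 addrC lmult.
rewrite normrN -[grad_x f _](subrKC (grad_x f (xb, wb))).
by rewrite (le_trans (ler_normD _ _))// lerD2l.
Qed.

(** For a fixed support [B], the bounded vectors supported in [B] at distance
at least [e] from the solutions [l'] form a compact set [far] on which the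
multiplier equation at [(xb, wb)] fails by a positive amount; nearby equations
then fail on it as well.  There are finitely many supports.  Keeping the support
under control is the point: it makes the constraints charged by [l'] active at the
perturbed point too. *)
Lemma limit_multiplier M e : 0 <= M -> 0 < e -> \forall z \near (xb, wb),
  forall l : 'rV[R]_m, `|l| <= M -> grad_x f z + l *m jac_x q z = 0 ->
  exists l' : 'rV[R]_m, [/\ forall k, l 0 k = 0 -> l' 0 k = 0,
    `|l'| <= M, `|l' - l| <= e &
    grad_x f (xb, wb) + l' *m jac_x q (xb, wb) = 0].
Proof.
move=> M0 e0.
pose p (l : 'rV[R]_m) := grad_x f (xb, wb) + l *m jac_x q (xb, wb).
pose box (B : {set 'I_m}) : set 'rV[R]_m :=
  [set l : 'rV[R]_m | forall k, k \notin B -> l 0 k = 0] `&`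
  [set l : 'rV[R]_m | `|l - 0| <= M].
have box_compact B : compact (box B).
  apply: (subclosed_compact _ (@compact_norm_ball R m 0 M)); last by move=> l [].
  apply: closedI; first by have := @closed_vanishing R m (fun k => k \notin B); apply.
  exact: compact_closed (@norm_hausdorff _ _) (@compact_norm_ball R m 0 M).
have supp_near : \forall z \near (xb, wb), forall B : {set 'I_m},
    forall l : 'rV[R]_m, box B l -> grad_x f z + l *m jac_x q z = 0 ->
    exists l' : 'rV[R]_m, [/\ box B l', `|l' - l| <= e & p l' = 0].
  apply: near_forall => B.
  pose far : set 'rV[R]_m := box B `&`
    \bigcap_(l' in  [set l' : 'rV[R]_m | box B l' /\ p l' = 0])
      ((fun l : 'rV[R]_m => `|l - l'|) @^-1` [set a | e <= a]).
  have far_compact : compact far.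
    apply: compact_closedI => //; apply: closed_bigI => l' _.
    by apply: closed_comp; [move=> l _; exact: dist_continuous|exact: closed_ge].
  have [[l1 far1]|far0] := pselect (far !=set0); last first.
    apply: near_always => z l Bl _; apply: contrapT => nex; apply: far0.
    exists l; split=> // l' [Bl' pl'] /=; rewrite leNgt; apply/negP => ll'.
    by apply: nex; exists l'; split=> //; rewrite distrC ltW.
  pose Phi l := dotp (p l) (p l).
  have [||l0 far_l0 l0min] := @EVT_min_rV R m Phi far _ far_compact.
  - by exists l1.
  - by apply: continuous_subspaceT; exact: sqr_affine_continuous.
  rewrite inE in far_l0; have [Bl0 far_l0'] := far_l0.
  have mu0 : 0 < enorm (p l0).
    rewrite lt_neqAle sqrtr_ge0 andbT; apply/eqP => pl0.
    have : p l0 = 0.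
      apply/eqP; rewrite -normr_eq0 eq_le normr_ge0 andbT pl0.
      exact: norm_le_enorm.
    move=> pl0'; have := far_l0' l0 (conj Bl0 pl0').
    by rewrite /= subrr normr0 leNgt e0.
  pose a := Num.sqrt n%:R * (1 + m%:R * M).
  have a0 : 0 <= a by rewrite mulr_ge0 ?sqrtr_ge0// addr_ge0// mulr_ge0.
  pose d := enorm (p l0) / (a + 1).
  have d0 : 0 < d by rewrite divr_gt0// ltr_wpDl.
  apply: filterS2 (grad_near f_exp d0) (jac_x_near q_exp d0) => z gradz jacz l Bl lz.
  apply: contrapT => nex.
  have far_l : far l.
    split=> // l' [Bl' pl'] /=; rewrite leNgt; apply/negP => ll'.
    by apply: nex; exists l'; split=> //; rewrite distrC ltW.
  have : enorm (p l0) <= enorm (p l).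
    rewrite -ler_sqr ?nnegrE ?sqrtr_ge0// !sqr_enorm.
    by apply: l0min; rewrite inE.
  have -> : p l = - ((grad_x f z - grad_x f (xb, wb))
      + l *m (jac_x q z - jac_x q (xb, wb))).
    by rewrite mulmxBr [in RHS]addrACA lz [in RHS]add0r -opprD opprK.
  apply/negP; rewrite -ltNge.
  apply: (@le_lt_trans _ _ (a * d)).
    apply: (le_trans (enorm_le_norm _)); rewrite normrN /a -mulrA ler_wpM2l ?sqrtr_ge0//.
    apply: (le_trans (ler_normD _ _)); rewrite mulrDl mul1r; apply: lerD => //.
    apply: (le_trans (mulmx_norm_le _ _)); rewrite -mulrA ler_wpM2l// ler_pM//.
    by have [_] := Bl; rewrite /= subr0.
  by rewrite /d mulrCA gtr_pMr// ltr_pdivrMr ?ltr_wpDl// mul1r ltrDl.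
apply: filterS supp_near => z supp_z l lM lz.
have [|//|l' [[l'B l'M] l'l pl']] := supp_z [set k | l 0 k != 0]%SET l.
  by split=> [k|]; rewrite /= ?subr0// inE negbK => /eqP.
exists l'; split=> //; last by move: l'M; rewrite /= subr0.
by move=> k lk; apply: l'B; rewrite inE lk eqxx.
Qed.

(** The trapezoid rule for the Lagrangian with the weights [l'] solving the
multiplier equation at the reference point, evaluated with the help of the
multiplier [l] of the perturbed one.  Errors are of size [Y = d + e t^2], with [e] also bounding [l' - l]. *)
Lemma stationary_upper : exists2 P, 0 <= P & forall e, 0 < e -> e <= 1 ->
  \forall z \near (xb, wb), program_stationary z ->
  f (z.1, wb) - f (xb, wb) <= P * (`|z.2 - wb| + e * `|z.1 - xb| ^+ 2).
Proof.
have [M M0 mult] := stationary_multiplier.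
pose C1 := C + 1.
have C10 : 0 <= C1 by rewrite addr_ge0.
pose P0 := 1 + n%:R * C1.
pose Pk := M + M * C1 + M * (n%:R * C1) + C1.
have nC1 : 0 <= n%:R * C1 by rewrite mulr_ge0.
have P00 : 0 <= P0 by rewrite addr_ge0.
have Pk0 : 0 <= Pk by rewrite !addr_ge0// mulr_ge0.
exists (P0 + m%:R * Pk) => [|e e0 e1]; first by rewrite addr_ge0// mulr_ge0.
have arith_sum (fx fb a b a' S0 S1 : R) : b + S0 = 0 -> a' + S1 = 0 ->
    fx - fb = fx - fb - 2^-1 * (a + b) + 2^-1 * (a - a')
      + (2^-1 * - S0 + 2^-1 * - S1) by move=> *; lra.
have arith_C (a b : R) : 0 <= a -> 0 <= b -> C * a + b <= C1 * (a + b).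
  by move=> a0 b0; rewrite /C1; have := mulr_ge0 C0 b0; nra.
have arith_P0 (a b Y : R) : 0 <= Y -> `|a| <= Y -> `|b| <= n%:R * (C1 * Y) ->
    a + 2^-1 * b <= P0 * Y.
  move=> Y0; rewrite !ler_norml => /andP[_ aY] /andP[_ bY].
  by have := mulr_ge0 nC1 Y0; rewrite /P0; lra.
have limit := limit_multiplier M0 e0.
have near_f : \forall z \near (xb, wb),
    `|grad_x f z - grad_x f (z.1, wb)| <= C * `|z.2 - wb| + e * `|z.1 - xb| /\
    `|f (z.1, wb) - f (xb, wb)
      - 2^-1 * dotp (grad_x f (z.1, wb) + grad_x f (xb, wb)) (z.1 - xb)|
      <= e * `|z.1 - xb| ^+ 2.
  by apply: filterS2 (exp_grad_shift f_exp e0)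
    (near_fst wb (exp_trapezoid f_exp e0)).
have near_q : \forall z \near (xb, wb), forall k,
  [/\ `|q z 0 k - q (z.1, wb) 0 k| <= C * `|z.2 - wb| + e * `|z.1 - xb| ^+ 2,
    `|grad_x (coordf q k) z - grad_x (coordf q k) (z.1, wb)|
      <= C * `|z.2 - wb| + e * `|z.1 - xb|,
    `|q (z.1, wb) 0 k - q (xb, wb) 0 k - 2^-1 *
      dotp (grad_x (coordf q k) (z.1, wb) + grad_x (coordf q k) (xb, wb)) (z.1 - xb)|
      <= e * `|z.1 - xb| ^+ 2 &
    `|q (z.1, wb) 0 k - q (xb, wb) 0 k
      - dotp (grad_x (coordf q k) (z.1, wb)) (z.1 - xb)|
      <= C * `|z.1 - xb| ^+ 2].
  apply: near_forall => k.
  have e1k := exp_shift (q_exp k) e0.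
  have e2k := exp_grad_shift (q_exp k) e0.
  have e3k := near_fst wb (exp_trapezoid (q_exp k) e0).
  have e4k := near_fst wb (exp_first_order (q_exp k)).
  by apply: filterS2 (near_and e1k e2k) (near_and e3k e4k) => z [a b] [c d]; split.
have close : \forall z \near (xb, wb), `|z.1 - xb| <= 1.
  apply/near_pair_radius; exists 1 => // x w xr _; exact: ltW.
have near1 := near_and (supported_near xb wb q_cont) close.
have near2 := near_and near1 (near_and near_f near_q).
apply: filterS2 (near_and mult limit) near2 => -[x w] [/= mult_z limit_z].
move=> [[supp t1] [[f_gs f_tr] near_k]] stat.
have [l [lsgn lsup lM lz]] := mult_z stat.
have [l' [l'sup l'M l'l l'z]] := limit_z l lM lz.
set u := x - xb in t1 f_gs f_tr near_k *; set t := `|u| in t1 f_gs f_tr near_k *.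
set dl := `|w - wb| in f_gs near_k *.
pose Y := dl + e * t ^+ 2.
have t0 : 0 <= t := normr_ge0 _. have dl0 : 0 <= dl := normr_ge0 _.
have et0 : 0 <= e * t ^+ 2 by rewrite mulr_ge0 ?sqr_ge0// ltW.
have Y0 : 0 <= Y by rewrite addr_ge0.
have CY : C * dl + e * t ^+ 2 <= C1 * Y by exact: arith_C.
have gsY : (C * dl + e * t) * t <= C1 * Y.
  apply: le_trans CY.
  have -> : (C * dl + e * t) * t = t * (C * dl) + e * t ^+ 2 by ring.
  by rewrite lerD2r ler_piMl// mulr_ge0.
pose G k := grad_x (coordf q k).
have sum0 : dotp (grad_x f (xb, wb)) u + \sum_k l' 0 k * dotp (G k (xb, wb)) u = 0.
  rewrite -[RHS](dotp0l u) -l'z dotpDl dotp_mulmx; congr (_ + _).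
  by apply: eq_bigr => k _; rewrite rowK.
have sum1 : dotp (grad_x f (x, w)) u + \sum_k l 0 k * dotp (G k (x, w)) u = 0.
  rewrite -[RHS](dotp0l u) -lz dotpDl dotp_mulmx; congr (_ + _).
  by apply: eq_bigr => k _; rewrite rowK.
pose A0 := dotp (grad_x f (x, wb) - grad_x f (x, w)) u.
pose E0 := f (x, wb) - f (xb, wb)
  - 2^-1 * dotp (grad_x f (x, wb) + grad_x f (xb, wb)) u.
pose D k := q (x, wb) 0 k - q (xb, wb) 0 k.
pose A k := dotp (G k (x, wb) - G k (x, w)) u.
pose E k := D k - 2^-1 * dotp (G k (x, wb) + G k (xb, wb)) u.
pose T k := l' 0 k * E k - l' 0 k * D k + 2^-1 * (l 0 k * A k)
  + 2^-1 * ((l' 0 k - l 0 k) * dotp (G k (x, wb)) u).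
(* By [sum0] and [sum1] all slopes cancel except those collected in [A0],
   [A] and the difference of the multipliers. *)
have decomposition : f (x, wb) - f (xb, wb) = E0 + 2^-1 * A0 + \sum_k T k.
  have sumT : \sum_k T k = 2^-1 * - (\sum_k l' 0 k * dotp (G k (xb, wb)) u)
     + 2^-1 * - (\sum_k l 0 k * dotp (G k (x, w)) u).
    rewrite -!sumrN !mulr_sumr -big_split; apply: eq_bigr => k _ /=.
    by rewrite /T /E /A dotpDl dotpBl; field.
  by rewrite sumT /E0 /A0 dotpDl dotpBl; exact: arith_sum.
have A0Y : `|A0| <= n%:R * (C1 * Y).
  apply: (le_trans (dotp_le _ _)); rewrite ler_wpM2l// distrC.
  by apply: le_trans gsY; rewrite ler_wpM2r.
have E0Y : `|E0| <= Y by apply: (le_trans f_tr); rewrite /Y lerDr.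
have T_le k : T k <= Pk * Y.
  have [k_shift k_gs k_tr k_fo] := near_k k.
  have lk : `|l 0 k| <= M := le_trans (coord_le_norm _ _ _) lM.
  have l'k : `|l' 0 k| <= M := le_trans (coord_le_norm _ _ _) l'M.
  have Ek : `|E k| <= Y by apply: (le_trans k_tr); rewrite /Y lerDr.
  have Ak : `|A k| <= n%:R * (C1 * Y).
    apply: (le_trans (dotp_le _ _)); rewrite ler_wpM2l// distrC.
    by apply: le_trans gsY; rewrite ler_wpM2r.
  (* A constraint in the support of [l] is active at both points. *)
  have Dk : l 0 k = 0 \/ `|D k| <= C1 * Y.
    have [lk0|lk0] := eqVneq (l 0 k) 0; [by left|right].
    have qx : q (x, w) 0 k = 0 by apply: contraNeq lk0 => qk; rewrite lsup.
    have qxb : q (xb, wb) 0 k = 0.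
      by apply: contraNeq lk0 => qk; rewrite (supp l lsup).
    by apply: le_trans CY; move: k_shift; rewrite /D qxb qx subr0 sub0r normrN.
  have lD : `|l' 0 k * D k| <= M * (C1 * Y).
    case: Dk => [lk0|Dk]; last by rewrite normrM; exact: ler_pM.
    by rewrite (l'sup k lk0) mul0r normr0 mulr_ge0// mulr_ge0.
  have lG : `|(l' 0 k - l 0 k) * dotp (G k (x, wb)) u| <= 2 * (C1 * Y).
    case: Dk => [lk0|Dk].
      by rewrite (l'sup k lk0) lk0 subrr mul0r normr0 !mulr_ge0.
    have Gk : `|dotp (G k (x, wb)) u| <= C1 * Y + C * t ^+ 2.
      rewrite -[dotp _ _](subKr (D k)) (le_trans (ler_normB _ _))// lerD//.
    have l'lk : `|l' 0 k - l 0 k| <= e := le_trans (coordB_le_norm _ _ _ _) l'l.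
    rewrite normrM; apply: (le_trans (ler_pM _ _ l'lk Gk)) => //.
    have e_a : e * (C1 * Y) <= C1 * Y by rewrite ler_piMl// mulr_ge0.
    have e_b : e * (C * t ^+ 2) <= C1 * Y.
      by rewrite mulrCA; apply: ler_pM => //; [rewrite /C1 lerDl|rewrite /Y lerDr].
    by rewrite [leLHS]mulrDr [leRHS]mulrDl mul1r lerD.
  have -> : Pk * Y = M * Y + M * (C1 * Y) + M * (n%:R * (C1 * Y)) + C1 * Y.
    by rewrite /Pk; ring.
  rewrite /T /E /A dotpDl dotpBl; apply: multiplier_term_le => //.
    by move: Ek; rewrite /E dotpDl.
  by move: Ak; rewrite /A dotpBl.
rewrite decomposition mulrDl; apply: lerD; last first.
  by rewrite -mulrA; apply: sum_le_const.
by rewrite -/Y; exact: arith_P0.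
Qed.

Variable eta : R.
Hypothesis eta0 : 0 < eta.
Hypothesis growth : \forall x \near xb, feas wb x ->
  eta * `|x - xb| ^+ 2 <= f (x, wb) - f (xb, wb).

(** Growth is assumed only on the feasible set of the reference program; metric
regularity at [(x, wb)] supplies a point [y] of that set at distance [O(Y)] from
[x], so passing from [x] to [y] costs [O(Y)] on both sides of the inequality. *)
Lemma growth_lower : exists2 P, 0 <= P & forall e, 0 < e -> e <= 1 ->
  \forall z \near (xb, wb), feas z.2 z.1 ->
  eta / 2 * `|z.1 - xb| ^+ 2 - P * (`|z.2 - wb| + e * `|z.1 - xb| ^+ 2)
    <= f (z.1, wb) - f (xb, wb).
Proof.
have [c c0 regular] := metric_regularity q_cont q_exp q_feas kappa0 pos_indep.
pose C1 := C + 1.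
have C10 : 0 <= C1 by rewrite addr_ge0.
pose a := Num.sqrt m%:R * C1 / c.
have a0 : 0 <= a by rewrite divr_ge0 ?(ltW c0)// mulr_ge0 ?sqrtr_ge0.
exists ((eta + C) * a) => [|e e0 e1]; first by rewrite mulr_ge0// addr_ge0// ltW.
have /near_radius[r1 r10 growth_r] := growth.
have /near_pair_radius[r2 r20 lip_r] := exp_lipschitz f_exp.
pose r := Num.min 1 (Num.min r1 r2).
have r0 : 0 < r by rewrite !lt_min ltr01 r10.
have q_shift : \forall z \near (xb, wb), forall k,
    `|q z 0 k - q (z.1, wb) 0 k| <= C * `|z.2 - wb| + e * `|z.1 - xb| ^+ 2.
  by apply: near_forall => k; exact: exp_shift (q_exp k) e e0.
have regular_wb := near_fst wb (near_slice regular).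
(* Chosen so that [y] also stays within [r] of [xb]: [|y - x| + |x - xb|] is at
   most [a * (d + t) + t]. *)
pose rho := r / (2 * (2 * a + 1)).
have a1 : 0 < 2 * a + 1 by rewrite ltr_wpDl// mulr_ge0.
have rho0 : 0 < rho by rewrite divr_gt0// mulr_gt0.
have close : \forall z \near (xb, wb),
    `|z.1 - xb| < Num.min 1 rho /\ `|z.2 - wb| < rho.
  apply/near_pair_radius; exists (Num.min 1 rho); first by rewrite lt_min ltr01.
  by move=> x w xr wr; split=> //; rewrite (lt_le_trans wr)// ge_min lexx orbT.
apply: filterS3 q_shift regular_wb close => -[x w] /= shift reg [xr wr] xfeas.
have [y yfeas /= yx] := reg.
move: xr; rewrite lt_min => /andP[x1 xr].
set t := `|x - xb| in shift x1 xr *; set dl := `|w - wb| in shift wr *.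
have t0 : 0 <= t := normr_ge0 _. have dl0 : 0 <= dl := normr_ge0 _.
pose Y := dl + e * t ^+ 2.
have et0 : 0 <= e * t ^+ 2 by rewrite mulr_ge0 ?sqr_ge0// ltW.
have Y0 : 0 <= Y by rewrite addr_ge0.
have yY : `|y - x| <= a * Y.
  rewrite -(ler_pM2l c0) (le_trans yx)//.
  apply: (le_trans (enorm_viol_le _ xfeas)).
  apply: (le_trans (enorm_le_norm _)).
  have -> : c * (a * Y) = Num.sqrt m%:R * (C1 * Y).
    by rewrite /a; field; rewrite gt_eqF.
  rewrite ler_wpM2l ?sqrtr_ge0//; apply: norm_le_coord => [|i k].
    by rewrite mulr_ge0.
  have -> : (q (x, wb) - q (x, w)) i k = - (q (x, w) 0 k - q (x, wb) 0 k).
    by rewrite ord1 !mxE opprB.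
  rewrite normrN (le_trans (shift k))// /C1 /Y.
  by have := mulr_ge0 C0 et0; lra.
have tt : t ^+ 2 <= t by rewrite expr2 ler_piMr// ltW.
have Yt : Y <= dl + t.
  by rewrite /Y lerD2l (le_trans _ tt)// ler_piMl ?sqr_ge0.
have yr : `|y - x| + t < r.
  have rhoE : (2 * a + 1) * rho = r / 2 by rewrite /rho; field; rewrite gt_eqF.
  by have := ler_wpM2l a0 Yt; have := ler_wpM2l a0 (ltW xr);
    have := ler_wpM2l a0 (ltW wr); lra.
have yr' : `|y - xb| < r.
  by rewrite -(subrKA x) (le_lt_trans (ler_normD _ _)).
move: yr'; rewrite !lt_min => /and3P[y1 yr1 yr2].
have xr2 : `|x - xb| < r2.
  have : t < r by apply: le_lt_trans yr; rewrite lerDr.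
  by rewrite !lt_min => /and3P[].
have fy := growth_r y yr1 yfeas.
have := lip_r y x yr2 xr2; rewrite /= ler_norml => /andP[_ fyx].
have yx1 : `|y - x| <= 1.
  have : r <= 1 by rewrite ge_min lexx.
  by move: yr; lra.
have yx2 : `|y - x| ^+ 2 <= a * Y.
  by apply: le_trans yY; rewrite expr2 ler_piMr.
have t_tri : t <= `|y - xb| + `|y - x|.
  by rewrite /t -(subrKA y) (le_trans (ler_normD _ _))// [leRHS]addrC (distrC x).
have t2 : t ^+ 2 / 2 <= `|y - xb| ^+ 2 + a * Y.
  have := sqr_ge0 (`|y - xb| - `|y - x|).
  by have := normr_ge0 (y - x); have := normr_ge0 (y - xb); nra.
have := ler_wpM2l (ltW eta0) t2; have := ler_wpM2l C0 yY.
by rewrite -/Y; lra.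
Qed.

(** With [e] small against [eta] the [t^2] term of the upper bound is absorbed by
the growth term of the lower one. *)
Lemma stationary_holder : exists2 K, 0 <= K & \forall z \near (xb, wb),
  program_stationary z -> `|z.1 - xb| ^+ 2 <= K * `|z.2 - wb|.
Proof.
have [P1 P10 upper] := stationary_upper.
have [P2 P20 lower] := growth_lower.
pose P := P1 + P2; have P0 : 0 <= P by rewrite addr_ge0.
pose e := Num.min 1 (eta / (4 * (P + 1))).
have P1' : 0 < P + 1 by rewrite ltr_wpDl.
have e0 : 0 < e by rewrite lt_min ltr01 divr_gt0// mulr_gt0.
have e1 : e <= 1 by rewrite ge_min lexx.
have Pe : P * e <= eta / 4.
  have : e <= eta / (4 * (P + 1)) by rewrite ge_min lexx orbT.
  by rewrite ler_pdivlMr ?mulr_gt0//; have := ltW e0; nra.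
exists (4 / eta * P); first by rewrite mulr_ge0// divr_ge0// ltW.
apply: filterS2 (upper e e0 e1) (lower e e0 e1) => -[x w] /= up low stat.
have {}up := up stat; have {}low := low stat.1.
have := ler_wpM2r (sqr_ge0 `|x - xb|) Pe.
have -> : 4 / eta * P * `|w - wb| = (eta / 4)^-1 * (P * `|w - wb|).
  by field; rewrite gt_eqF.
rewrite ler_pdivlMl ?divr_gt0//.
by move: up low; rewrite /P; lra.
Qed.

Lemma feas_closed w : closed (feas w).
Proof.
rewrite (_ : feas w = (fun y => resid eqs q (y, w)) @^-1` [set a | a = 0]).
  apply: closed_comp; last exact: closed_eq.
  move=> y _; apply: (@continuous_comp _ _ _ (fun y => (y, w)) (resid eqs q)).
    exact: slice_continuous.
  exact: resid_continuous.
rewrite predeqE => y; split => /= [y0|]; last exact: resid_eq0.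
by rewrite /resid y0; apply/eqP; rewrite -sqrf_eq0 sqr_enorm dotp0l.
Qed.

(** The minimizer [x] over the feasible part of the ball of radius [rho] does
no worse than a feasible point [y] close to [xb], while [growth_lower] would make
its value too large on the boundary of the ball. *)
Lemma minimizer_exists r : 0 < r -> \forall w \near wb, exists x,
  [/\ `|x - xb| < r, feas w x &
    \forall y \near x, feas w y -> f (x, w) <= f (y, w)].
Proof.
move=> r0.
have [c c0 regular] := metric_regularity q_cont q_exp q_feas kappa0 pos_indep.
have [P P0 lower] := growth_lower.
pose e := Num.min 1 (eta / (8 * (P + 1))).
have P1' : 0 < P + 1 by rewrite ltr_wpDl.
have e0 : 0 < e by rewrite lt_min ltr01 divr_gt0// mulr_gt0.
have e1 : e <= 1 by rewrite ge_min lexx.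
have Pe : (P + 1) * e <= eta / 8.
  have : e <= eta / (8 * (P + 1)) by rewrite ge_min lexx orbT.
  by rewrite ler_pdivlMr ?mulr_gt0//; lra.
have /near_pair_radius[r1 r10 low] := near_and (lower e e0 e1) (exp_shift f_exp e0).
pose rho := Num.min r r1 / 2.
have rmin0 : 0 < Num.min r r1 by rewrite lt_min r0.
have rho0 : 0 < rho by rewrite divr_gt0.
have : rho < Num.min r r1 by rewrite ltr_pdivrMr// ltr_pMr// ltr1n.
rewrite lt_min => /andP[rho_r rho_r1].
(* The value at [y] and the parameter shift each cost at most [d], and
   [eta / 4 * t ^+ 2 <= 2 * d] must force [t < rho]. *)
pose d := eta / 16 * rho ^+ 2.
have d0 : 0 < d by rewrite mulr_gt0 ?divr_gt0// exprn_gt0.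
have /cvgrPdist_le/(_ d d0)/near_pair_radius[r2 r20 f_near] := @f_cont (xb, wb).
have PC0 : 0 < P + C + 1 by rewrite ltr_wpDl// addr_ge0.
have w_near : \forall w \near wb,
    [/\ `|w - wb| < r1, `|w - wb| < r2 & `|w - wb| < d / (P + C + 1)].
  apply/near_radius; exists (Num.min r1 (Num.min r2 (d / (P + C + 1)))).
    by rewrite !lt_min r10 r20 divr_gt0.
  by move=> w; rewrite !lt_min => /and3P[].
have crho0 : 0 < c * Num.min rho r2 by rewrite mulr_gt0// lt_min rho0.
have resid_near : \forall z \near (xb, wb), resid eqs q z < c * Num.min rho r2.
  have residb : resid eqs q (xb, wb) = 0.
    by rewrite /resid q_feas; apply/eqP; rewrite -sqrf_eq0 sqr_enorm dotp0l.
  have := @resid_continuous _ _ _ _ eqs q q_cont (xb, wb).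
  by rewrite /continuous_at residb => /cvgr_lt/(_ _ crho0).
apply: filterS3 (near_slice2 regular) (near_slice2 resid_near) w_near.
move=> w /= [y yfeas yxb] resid_w [wr1 wr2 wd].
have : `|y - xb| < Num.min rho r2 by rewrite -(ltr_pM2l c0) (le_lt_trans yxb).
rewrite lt_min => /andP[y_rho y_r2].
pose K : set 'rV[R]_n := [set x | `|x - xb| <= rho] `&` feas w.
have K_compact : compact K.
  by apply: compact_closedI; [exact: compact_norm_ball|exact: feas_closed].
have [||x Kx xmin] := @EVT_min_rV R n (fun x => f (x, w)) K _ K_compact.
- by exists y; split=> //=; exact: ltW.
- apply: continuous_subspaceT => x.
  apply: (@continuous_comp _ _ _ (fun y => (y, w)) f); last exact: f_cont.
  exact: slice_continuous.
rewrite inE in Kx; have [/= x_rho xfeas] := Kx.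
have fxy : f (x, w) <= f (y, w) by apply: xmin; rewrite inE; split=> //=; exact: ltW.
have [/= lowx shiftx] := low x w (le_lt_trans x_rho rho_r1) wr1.
have {}lowx := lowx xfeas.
have /= := f_near y w y_r2 wr2.
rewrite ler_norml => /andP[fy _].
move: shiftx; rewrite ler_norml => /andP[shiftx _].
have Pd : (P + C) * `|w - wb| <= d.
  by move: wd; rewrite ltr_pdivlMr//; have := normr_ge0 (w - wb); lra.
have t2 : eta / 4 * `|x - xb| ^+ 2 <= 2 * d.
  have := ler_wpM2r (sqr_ge0 `|x - xb|) Pe; lra.
have x_lt : `|x - xb| < rho.
  rewrite -ltr_sqr ?nnegrE ?(ltW rho0)//.
  have eta4 : 0 < eta / 4 by rewrite divr_gt0.
  by rewrite -(ltr_pM2l eta4) (le_lt_trans t2)// /d; have := d0; rewrite /d; lra.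
exists x; split=> //; first exact: lt_trans rho_r.
apply/near_radius; exists (rho - `|x - xb|); first by rewrite subr_gt0.
move=> x' x'x x'feas; apply: xmin; rewrite inE; split=> //=.
rewrite -(subrKA x) (le_trans (ler_normD _ _))//.
by move: x'x; lra.
Qed.

End Program.

(** * Equalities and inequalities as one system *)

Section Assembly.
Context {R : realType} {n s mI mE : nat}.
Variables (g : 'rV[R]_n * 'rV[R]_s -> 'rV[R]_mI).
Variables (h : 'rV[R]_n * 'rV[R]_s -> 'rV[R]_mE).

Definition constraints z : 'rV[R]_(mI + mE) := row_mx (g z) (h z).

Definition is_equality (k : 'I_(mI + mE)) : bool :=
  if fintype.split k is inr _ then true else false.

Lemma is_equality_lshift i : is_equality (lshift mE i) = false.
Proof. by rewrite /is_equality (unsplitK (inl i)). Qed.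

Lemma is_equality_rshift i : is_equality (rshift mI i) = true.
Proof. by rewrite /is_equality (unsplitK (inr i)). Qed.

Lemma feasibleE w : feasible g h w =
  [set x | viol is_equality (constraints (x, w)) = 0].
Proof.
rewrite predeqE => x; split => [[gx hx]|/rowP qx].
  apply/rowP => k; rewrite !mxE /is_equality; case: splitP => j _ /=.
    by rewrite max_r.
  by rewrite hx mxE.
split=> [i|].
  have := qx (lshift mE i); rewrite !mxE is_equality_lshift (unsplitK (inl i)).
  by move=> /eqP; rewrite -[X in _ == X]/(0 : R) eq_maxr.
apply/rowP => j; have := qx (rshift mI j).
by rewrite !mxE is_equality_rshift (unsplitK (inr j)).
Qed.

Lemma coordf_lshift i : coordf constraints (lshift mE i) = coordf g i.
Proof. by apply/funext => z; rewrite /coordf row_mxEl. Qed.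

Lemma coordf_rshift i : coordf constraints (rshift mI i) = coordf h i.
Proof. by apply/funext => z; rewrite /coordf row_mxEr. Qed.

Lemma jac_constraints z : jac_x constraints z = col_mx (jac_x g z) (jac_x h z).
Proof.
apply/row_matrixP => k; rewrite rowK -(splitK k); case: (fintype.split k) => i /=.
  by rewrite coordf_lshift rowKu rowK.
by rewrite coordf_rshift rowKd rowK.
Qed.

Lemma constraints_continuous :
  continuous g -> continuous h -> continuous constraints.
Proof.
move=> cg ch z; apply/cvgrPdist_le => e e0.
have /cvgrPdist_le/(_ e e0) near_g := cg z.
have /cvgrPdist_le/(_ e e0) near_h := ch z.
apply: filterS2 near_g near_h => z' gz hz.
apply: norm_le_coord => [|i k]; first exact: ltW.
rewrite ord1 mxE [X in _ + X]mxE.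
rewrite -(splitK k); case: (fintype.split k) => j /=.
  by rewrite !row_mxEl; apply: le_trans gz; exact: coordB_le_norm.
by rewrite !row_mxEr; apply: le_trans hz; exact: coordB_le_norm.
Qed.

(** Pairing [r = l *m J] with the Mangasarian-Fromovitz direction [d] kills the
equality part and bounds the inequality part of [l] by [r]; the equality part is
then recovered from [r] by the linear independence of its gradients. *)
Lemma MFCQ_pos_indep xb wb : feasible g h wb xb -> MFCQ g h xb wb ->
  exists2 kappa, 0 < kappa & forall l, sign_ok is_equality l ->
    supported constraints l (xb, wb) ->
    kappa * `|l| <= `|l *m jac_x constraints (xb, wb)|.
Proof.
move=> [gxb hxb] [h_free [d [hd gd]]].
set zb := (xb, wb) in gxb hxb h_free hd gd *.
have [c c0 gdc] : exists2 c, 0 < c & forall i, g zb 0 i = 0 ->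
    dotp (grad_x (coordf g i) zb) d <= - c.
  have : \forall c \near (0 : R)^'+, forall i, g zb 0 i = 0 ->
      dotp (grad_x (coordf g i) zb) d <= - c.
    apply: (@filter_forall _ _ (fun i c => g zb 0 i = 0 ->
      dotp (grad_x (coordf g i) zb) d <= - c)) => i.
    have [gi|gi] := pselect (g zb 0 i = 0); last by apply: nearW.
    near=> c => _; rewrite lerNr; near: c; apply: nbhs_right_le.
    by rewrite oppr_gt0 gd.
  move=> near_c; suff /filter_ex[c []] : \forall c \near (0 : R)^'+,
    0 < c /\ forall i, g zb 0 i = 0 -> dotp (grad_x (coordf g i) zb) d <= - c.
    by exists c.
  by near=> c; split; near: c; [exact: nbhs_right_gt|exact: near_c].
pose Jg := jac_x g zb; pose Jh := jac_x h zb.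
pose A := n%:R * `|d| / c.
have A0 : 0 <= A by rewrite divr_ge0 ?(ltW c0)// mulr_ge0.
pose B := n%:R * `|pinvmx Jh| * (1 + mI%:R * `|Jg| * A).
have B0 : 0 <= B.
  by rewrite !mulr_ge0// addr_ge0// mulr_ge0// mulr_ge0.
have AB0 : 0 < A + B + 1 by rewrite ltr_wpDl// addr_ge0.
exists (A + B + 1)^-1; first by rewrite invr_gt0.
move=> l lsgn lsup; rewrite ler_pdivrMl// jac_constraints -/Jg -/Jh.
pose lg := lsubmx l; pose lh := rsubmx l.
have lE : l = row_mx lg lh by rewrite hsubmxK.
have lg_ge0 i : 0 <= lg 0 i by rewrite mxE lsgn// is_equality_lshift.
have lg_sup i : g zb 0 i != 0 -> lg 0 i = 0.
  by move=> gi; rewrite mxE lsup// /constraints row_mxEl.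
rewrite [in leRHS]lE mul_row_col; set r := lg *m Jg + lh *m Jh.
have dotr : dotp r d = \sum_i lg 0 i * dotp (grad_x (coordf g i) zb) d.
  rewrite dotpDl !dotp_mulmx [X in _ + X]big1 ?addr0 => [|j _].
    by apply: eq_bigr => i _; rewrite rowK.
  by rewrite rowK hd mulr0.
have lgA : `|lg| <= A * `|r|.
  apply: norm_le_coord => [|i j]; first by rewrite mulr_ge0.
  rewrite ord1 ger0_norm// /A mulrAC ler_pdivlMr// mulrAC -mulrA.
  have : - dotp r d <= n%:R * (`|r| * `|d|).
    by apply: le_trans (dotp_le r d); rewrite -normrN ler_norm.
  apply: le_trans.
  rewrite dotr -sumrN (bigD1 j)//= -[leLHS]addr0 lerD//.
    have [gj|gj] := eqVneq (g zb 0 j) 0; last by rewrite lg_sup// !mul0r oppr0.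
    by rewrite -mulrN ler_wpM2l// lerNr gdc.
  apply: sumr_ge0 => k _.
  have [gk|gk] := eqVneq (g zb 0 k) 0; last by rewrite lg_sup// !mul0r oppr0.
  by rewrite -mulrN mulr_ge0// oppr_ge0 ltW// gd.
have lhB : `|lh| <= B * `|r|.
  have -> : lh = (r - lg *m Jg) *m pinvmx Jh.
    by rewrite /r addrAC subrr add0r -mulmxA mulmxVp// mulmx1.
  apply: (le_trans (mulmx_norm_le _ _)).
  have rl : `|r - lg *m Jg| <= (1 + mI%:R * `|Jg| * A) * `|r|.
    apply: (le_trans (ler_normB _ _)); rewrite mulrDl mul1r lerD2l.
    apply: (le_trans (mulmx_norm_le _ _)).
    have -> : mI%:R * `|Jg| * A * `|r| = mI%:R * (`|Jg| * (A * `|r|)) by ring.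
    by rewrite ler_wpM2l// mulrC ler_wpM2l.
  have -> : B * `|r| = n%:R * (`|pinvmx Jh| * ((1 + mI%:R * `|Jg| * A) * `|r|)).
    by rewrite /B; ring.
  by rewrite ler_wpM2l// mulrC ler_wpM2l.
apply: norm_le_coord => [|i k]; first by rewrite mulr_ge0// ltW.
have r0 := normr_ge0 r.
have Ar := mulr_ge0 A0 r0; have Br := mulr_ge0 B0 r0.
rewrite ord1 lE -(splitK k); case: (fintype.split k) => j /=.
  by rewrite row_mxEl (le_trans (coord_le_norm _ _ _))// (le_trans lgA)//; lra.
by rewrite row_mxEr (le_trans (coord_le_norm _ _ _))// (le_trans lhB)//; lra.
Unshelve. all: by end_near. Qed.

End Assembly.

(** * The stability theorem *)

Section Auxiliary.
Context {R : realType}.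

Lemma common_constant (I : finType) (Q : R -> I -> Prop) :
  (forall i C C', C <= C' -> Q C i -> Q C' i) ->
  (forall i, exists2 C, 0 <= C & Q C i) ->
  exists2 C, 0 <= C & forall i, Q C i.
Proof.
move=> Qmono Qex.
have /choice[C QC] : forall i, exists C, 0 <= C /\ Q C i.
  by move=> i; have [C C0 QC] := Qex i; exists C.
exists (\sum_i C i); first by apply: sumr_ge0 => i _; exact: (QC i).1.
move=> i; apply: Qmono (QC i).2; rewrite (bigD1 i)//= lerDl.
by apply: sumr_ge0 => j _; exact: (QC j).1.
Qed.

Lemma mem_scaled_eball n (x xb : 'rV[R]_n) (a : R) : enorm (x - xb) <= a ->
  [set xb + a *: b | b in @eball R n] x.
Proof.
move=> xa; have a0 : 0 <= a := le_trans (sqrtr_ge0 _) xa.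
have [aE|an0] := eqVneq a 0.
  (* Then [x = xb], and the center of the ball represents it. *)
  exists 0.
    by rewrite /eball /= (le_trans (enorm_le_norm _))// normr0 mulr0.
  rewrite scaler0 addr0; apply/esym/eqP; rewrite -subr_eq0 -normr_eq0.
  by rewrite eq_le normr_ge0 andbT -aE (le_trans (norm_le_enorm _)).
exists (a^-1 *: (x - xb)); last by rewrite scalerA mulfV// scale1r subrKC.
rewrite /eball /= -ler_sqr ?nnegrE ?sqrtr_ge0// sqr_enorm dotpZl dotpZr.
rewrite -sqr_enorm mulrA -expr2 exprVn expr1n ler_pdivrMl ?mulr1; last first.
  by rewrite exprn_gt0// lt_neqAle eq_sym an0.
by rewrite ler_sqr ?nnegrE ?sqrtr_ge0.
Qed.

Lemma local_minimizer_stationary n (phi : 'rV[R]_n -> R) (G : set 'rV[R]_n) x xi :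
  differentiable phi x -> (forall u, 'D_u phi x = - dotp xi u) -> G x ->
  (\forall y \near x, G y -> phi x <= phi y) -> regular_normal_cone G x xi.
Proof.
move=> dphi phi_grad Gx xmin; apply/regular_normal_coneP => // e e0.
apply: filterS2 (diff_eps dphi e0) xmin => y.
rewrite phi_grad ler_norml opprK => /andP[_ y_eps] ymin Gy.
apply: (@le_trans _ _ (e * `|y - x|)); last first.
  by rewrite ler_wpM2l ?(ltW e0)// norm_le_enorm.
by have := ymin Gy; lra.
Qed.

End Auxiliary.

Theorem corollary5 (R : realType) (n s mI mE : nat)
  (f : 'rV[R]_n * 'rV[R]_s -> R)
  (g : 'rV[R]_n * 'rV[R]_s -> 'rV[R]_mI)
  (h : 'rV[R]_n * 'rV[R]_s -> 'rV[R]_mE)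
  (xbar : 'rV[R]_n) (wbar : 'rV[R]_s)
  (f_cont : continuous f) (g_cont : continuous g) (h_cont : continuous h)
  (standing : standing_assumptions f g h xbar wbar)
  (xbar_feasible : feasible g h wbar xbar)
  (growth : quadratic_growth f g h xbar wbar)
  (mfcq : MFCQ g h xbar wbar)
  (f_C2 : C2_near f (xbar, wbar))
  (g_C2 : C2_near g (xbar, wbar))
  (h_C2 : C2_near h (xbar, wbar)) :
  exists (U : set 'rV[R]_n) (W : set 'rV[R]_s) (L : R),
    [/\ nbhs xbar U, nbhs wbar W, 0 < L &
      forall w, W w ->
        [/\ local_minimizers f g h w `&` U !=set0,
            local_minimizers f g h w `&` U
              `<=` stationary_points f g h w `&` U &
            stationary_points f g h w `&` U
              `<=` [set xbar + (L * enorm (w - wbar) `^ 2^-1) *: b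
                   | b in @eball R n]]].
Proof.
have [U0 [W0 [U0xb W0wb f_smooth g_smooth h_smooth]]] := standing.
pose q := constraints g h; pose eqs := @is_equality mI mE.
have q_cont : continuous q by exact: constraints_continuous.
have q_feas : viol eqs (q (xbar, wbar)) = 0 by rewrite feasibleE in xbar_feasible.
have q_smooth k : partially_smooth U0 W0 xbar wbar (coordf q k).
  rewrite -(splitK k); case: (fintype.split k) => i /=.
    by rewrite coordf_lshift.
  by rewrite coordf_rshift.
have [Cf Cf0 f_expf] := smooth_expansion U0xb W0wb f_smooth.
have [Cq Cq0 q_expq] := @common_constant _ _
  (fun C k => expansion C xbar wbar (coordf q k))
  (fun k C C' CC' => expansionW CC')
  (fun k => smooth_expansion U0xb W0wb (q_smooth k)).
pose C := Cf + Cq.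
have C0 : 0 <= C by rewrite addr_ge0.
have f_exp : expansion C xbar wbar f by apply: expansionW f_expf; rewrite lerDl.
have q_exp k : expansion C xbar wbar (coordf q k).
  by apply: expansionW (q_expq k); rewrite lerDr.
have [kappa kappa0 pos_indep] := MFCQ_pos_indep xbar_feasible mfcq.
have [eta [V [eta0 Vxb grow]]] := growth.
have q_growth : \forall x \near xbar, viol eqs (q (x, wbar)) = 0 ->
    eta * `|x - xbar| ^+ 2 <= f (x, wbar) - f (xbar, wbar).
  apply: filterS Vxb => x Vx xfeas.
  apply: le_trans (grow x _); last by split; rewrite ?feasibleE.
  rewrite ler_wpM2l ?(ltW eta0)// ler_sqr ?nnegrE ?sqrtr_ge0//.
  exact: norm_le_enorm.
have [K K0 holder] := stationary_holder q_cont C0 f_exp q_exp q_feas kappa0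
  pos_indep eta0 q_growth.
have /near_pair_radius[r r0 good] := near_and holder (exp_diff f_exp).
have exist := minimizer_exists f_cont q_cont C0 f_exp q_exp q_feas kappa0
  pos_indep eta0 q_growth r0.
pose L := Num.sqrt n%:R * Num.sqrt K + 1.
have L0 : 0 < L by rewrite ltr_wpDl// mulr_ge0 ?sqrtr_ge0.
exists [set x | `|x - xbar| < r], [set w | `|w - wbar| < r /\
  exists x, [/\ `|x - xbar| < r, viol eqs (q (x, w)) = 0 &
    \forall y \near x, viol eqs (q (y, w)) = 0 -> f (x, w) <= f (y, w)]], L.
have near_r p (c : 'rV[R]_p) : \forall x \near c, `|x - c| < r.
  by apply/near_radius; exists r.
split=> //; first exact: near_r.
  exact: near_and (near_r _ wbar) exist.
move=> w /= [wr [xw [xwr xwfeas xwmin]]]; split.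
- exists xw; split=> //; split; first by rewrite feasibleE.
  by rewrite feasibleE.
- move=> x [[xfeas xmin] xr]; split=> //.
  have [_ /= fdiff] := good x w xr wr.
  exists (- grad_x f (x, w)); last by rewrite subrr.
  apply: (local_minimizer_stationary fdiff) => // u.
  by rewrite derive_grad_x// dotpNl opprK.
- move=> x [[xi xi_normal xiE] xr].
  have xi_grad : xi = - grad_x f (x, w).
    by apply/eqP; rewrite -addr_eq0 addrC -xiE.
  have [/= xholder _] := good x w xr wr.
  apply: mem_scaled_eball.
  have {}xholder : `|x - xbar| ^+ 2 <= K * `|w - wbar|.
    by apply: xholder; rewrite /program_stationary /= -xi_grad -feasibleE.
  rewrite powR12_sqrt ?sqrtr_ge0// (le_trans (enorm_le_norm _))//.
  have : `|x - xbar| <= Num.sqrt K * Num.sqrt (enorm (w - wbar)).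
    rewrite -sqrtrM// -[leLHS]normr_id -sqrtr_sqr ler_sqrt; last first.
      by rewrite mulr_ge0 ?sqrtr_ge0.
    by rewrite (le_trans xholder)// ler_wpM2l// norm_le_enorm.
  move=> /(ler_wpM2l (sqrtr_ge0 n%:R)) /le_trans; apply.
  by rewrite mulrA ler_wpM2r ?sqrtr_ge0// /L lerDl.
Qed.
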